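(* Suppose there exists a probability measure $\mathbb{Q}'$ on $\mathcal{G}_\infty$, equivalent to $\mathbb{Q}$, such that hypothesis (H) holds under $\mathbb{Q}'$, i.e. every $(\mathbb{Q}',\mathbb{F})$-martingale is a $(\mathbb{Q}',\mathbb{G})$-martingale. Then the global optional splitting formula holds at $\tau$ with respect to $\mathbb{F}$.
   Context: Let $(\Omega,\mathcal{A},\mathbb{Q})$ be a probability space with a right-continuous filtration $\mathbb{F}=(\mathcal{F}_t)_{t\ge0}$ such that $\mathcal{F}_0$ contains $\mathcal{N}^{\mathcal{F}_\infty}$, where for a $\sigma$-algebra $\mathcal{T}\subset\mathcal{A}$, $\mathcal{N}^{\mathcal{T}}$ denotes the $\sigma$-algebra generated by all subsets of $\mathcal{T}$-measurable $\mathbb{Q}$-null sets. Let $\tau$ be a random variable with values in $[0,\infty]$, let $\mathcal{N}=\mathcal{N}^{\sigma(\tau)\vee\mathcal{F}_\infty}$, and let $\mathbb{G}=(\mathcal{G}_t)_{t\ge0}$ with $\mathcal{G}_t=\mathcal{N}\vee\bigcap_{s>t}(\mathcal{F}_s\vee\sigma(\tau\wedge s))$. Identities are understood up to indistinguishability outside an $\mathcal{N}$-measurable $\mathbb{Q}$-null set. The global optional splitting formula at $\tau$ holds if for every $\mathbb{G}$-optional process $Y$ there exist $Y'\in\mathcal{O}(\mathbb{F})$ and a $\mathcal{B}[0,\infty]\otimes\mathcal{O}(\mathbb{F})$-measurable function $Y''$ on $[0,\infty]\times(\mathbb{R}_+\times\Omega)$ with $Y=Y'\mathbf{1}_{[0,\tau)}+Y''(\tau)\mathbf{1}_{[\tau,\infty)}$,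 where $Y''(\tau)(t,\omega)=Y''(\tau(\omega),t,\omega)$. *)

(* Defs.v *)
From HB Require Import structures.
From mathcomp Require Import all_boot all_order all_algebra.
From mathcomp Require Import all_classical all_reals all_analysis measurable_realfun.
Set Implicit Arguments. Unset Strict Implicit. Unset Printing Implicit Defensive.
Import Order.TTheory GRing.Theory Num.Theory.
Import numFieldNormedType.Exports.
Local Open Scope classical_set_scope.
Local Open Scope ring_scope.

Section Defs.
Context {R : realType}.

Definition sigma_of {T : Type} {d} {V : measurableType d} (X : T -> V)
  : set (set T) := [set X @^-1` B | B in [set B | measurable B]].

Definition join {T : Type} (S1 S2 : set (set T)) : set (set T) :=
  <<s S1 `|` S2 >>.

Definition nullgen {d} {T : measurableType d} (P : set T -> \bar R)
  (S : set (set T)) : set (set T) :=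
  <<s [set A | exists B, [/\ S B, P B = 0%E & A `<=` B] ] >>.

Definition infty_sa {T : Type} (F : R -> set (set T)) : set (set T) :=
  <<s \bigcup_(t in `[0, +oo[%classic) F t >>.

Definition is_filtration {d} {T : measurableType d} (F : R -> set (set T)) :=
  (forall t, 0 <= t -> sigma_algebra setT (F t) /\ F t `<=` measurable) /\
  (forall s t, 0 <= s -> s <= t -> F s `<=` F t).

Definition right_continuous_filtration {T : Type} (F : R -> set (set T)) :=
  forall t, 0 <= t -> F t = \bigcap_(s in `]t, +oo[%classic) F s.

Definition Nsa {d} {T : measurableType d} (P : set T -> \bar R)
  (F : R -> set (set T)) (tau : T -> \bar R) : set (set T) :=
  nullgen P (join (sigma_of tau) (infty_sa F)).

Definition Gfilt {d} {T : measurableType d} (P : set T -> \bar R)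
  (F : R -> set (set T)) (tau : T -> \bar R) (t : R) : set (set T) :=
  join (Nsa P F tau)
    (\bigcap_(s in `]t, +oo[%classic)
        join (F s) (sigma_of (fun w => Order.min (tau w) s%:E))).

Definition Ginf_gen {d} {T : measurableType d} (P : set T -> \bar R)
  (F : R -> set (set T)) (tau : T -> \bar R) : set (set T) :=
  \bigcup_(t in `[0, +oo[%classic) Gfilt P F tau t.

Definition adapted {T : Type} (H : R -> set (set T)) (X : R -> T -> R) :=
  forall t, 0 <= t -> forall B : set R, measurable B -> H t (X t @^-1` B).

Definition martingale {d} {T : measurableType d} (P : probability T R)
  (H : R -> set (set T)) (M : R -> T -> R) :=
  [/\ adapted H M,
      (forall t, 0 <= t -> P.-integrable setT (EFin \o M t)) &
      (forall s t, 0 <= s -> s <= t -> forall A, H s A ->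
         (\int[P]_(x in A) (M t x)%:E = \int[P]_(x in A) (M s x)%:E)%E)].

Definition cadlag {T : Type} (X : R -> T -> R) :=
  forall w t, 0 <= t ->
    (X^~ w x @[x --> t^'+] --> X t w) /\
    (0 < t -> cvg (X^~ w x @[x --> t^'-])).

Definition timedom {T : Type} : set (R * T) := [set p | 0 <= p.1].

Definition optional {T : Type} (H : R -> set (set T)) : set (set (R * T)) :=
  <<s timedom, [set S | exists (X : R -> T -> R) (B : set R),
        [/\ cadlag X, adapted H X, measurable B &
             S = timedom `&` [set p | B (X p.1 p.2)]]] >>.

Definition process_measurable {T : Type} (S : set (set (R * T)))
  (Y : R -> T -> R) :=
  forall B : set R, measurable B -> S (timedom `&` [set p | B (Y p.1 p.2)]).

Definition ext_timedom {T : Type} : set (\bar R * (R * T)) :=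
  [set q | (0 <= q.1)%E /\ 0 <= q.2.1].

Definition borel_optional {T : Type} (H : R -> set (set T))
  : set (set (\bar R * (R * T))) :=
  <<s ext_timedom, [set S | exists (A : set (\bar R)) (C : set (R * T)),
        [/\ measurable A, A `<=` [set x | (0 <= x)%E], optional H C &
             S = A `*` C]] >>.

Definition param_measurable {T : Type} (H : R -> set (set T))
  (Y : \bar R -> R -> T -> R) :=
  forall B : set R, measurable B ->
    borel_optional H (ext_timedom `&` [set q | B (Y q.1 q.2.1 q.2.2)]).

Definition global_optional_splitting {d} {T : measurableType d}
  (P : probability T R) (F : R -> set (set T)) (tau : T -> \bar R) :=
  forall Y : R -> T -> R,
    process_measurable (optional (Gfilt P F tau)) Y ->
    exists Y' : R -> T -> R, exists Y'' : \bar R -> R -> T -> R,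
      [/\ process_measurable (optional F) Y',
          param_measurable F Y'' &
          exists E : set T, [/\ Nsa P F tau E, P.-negligible E &
            forall w, ~ E w -> forall t, 0 <= t ->
              Y t w = if (t%:E < tau w)%E then Y' t w else Y'' (tau w) t w]].

End Defs.

(* Main.v *)
(* A G-stopping time is represented by the increasing right-continuous family
   [L t = {T <= t}].  The level sets of a cadlag G-adapted process are countable
   Boolean combinations of such families, so it suffices to split [{(t, w) | L t w}],
   splittable sets forming a sigma-algebra.  Before [tau] this is the trace
   of a family adapted to F, since G and F coincide there.  After [tau] one must
   decide at time [t], from [tau] and F-optional data only, whether [T <= t].

   Under Q', hypothesis (H) makes [Q'(tau in I, tau <= t | F_oo)] and
   [Q'(tau in I, tau <= t, T <= t | F_oo)] F_t-measurable for every Borel set I;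
   both are increasing in [t], hence have F-optional versions [H_I] and [A_I].
   Let I shrink to [tau] along finite partitions.  At time [max T tau] the ratio
   [A_I / H_I] is a conditional distribution function evaluated at its own
   variable, so it is at most [l] with probability at most [l] and does not tend
   to 0; at times in [tau, T) it tends to 0 along a subsequence, by a weak-type
   maximal inequality.  Hence [T <= t] holds if and only if [T < t] or
   [A_I / H_I] does not tend to 0 at time [t]. *)
Require Import Defs.
From HB Require Import structures.
From mathcomp Require Import all_boot all_order all_algebra.
From mathcomp Require Import all_classical all_reals all_analysis measurable_realfun.
From mathcomp Require Import lra.
Import Order.TTheory GRing.Theory Num.Theory.
Import numFieldNormedType.Exports.
Local Open Scope classical_set_scope.
Local Open Scope ring_scope.
Set Implicit Arguments.
Unset Strict Implicit.

(** * Conditional probabilities *)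

(** The obstacle is that a right limit does not commute with a join. For every s > t an event of
    [Gfilt] at time t is, up to null sets, a function of [tau] and of F_s, but nothing provides a
    limit of these functions that is F_t-measurable for each fixed value of [tau]. Strictly past
    information is harmless: what is known at r < t can be read from [tau] and F_s for a rational s
    between r and t. This is why only the instant T = t has to be detected.

    Conditioning on the whole of F_oo lets the events that approximate {T <= q} on the cells of
    [tau] be taken in F_oo, and lets one conditioning sigma-algebra serve all times in the maximal
    inequality. Hypothesis (H) enters to make the resulting processes adapted to F.

    The ratio is never formed as a quotient: A > l H is a level set of the cadlag process A - l H.
    The weak-type bound at level 2^-p costs a factor 2^p, so errors 4^-k are prescribed in the
    approximation and leave a summable bound. *)

Definition meas_wrt {R : realType} {T : Type} (S : set (set T)) (g : T -> R) :=
  forall B : set R, measurable B -> S (g @^-1` B).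

Section conditional_probability.
Context {R : realType} {d : measure_display} {T : measurableType d}.
Variable P : probability T R.

Lemma meas_wrtP (S : set (set T)) (g : T -> R) : sigma_algebra setT S ->
  meas_wrt S g <-> measurable_fun (setT : set (g_sigma_algebraType S)) g.
Proof.
move=> hS; split=> [mg _ B mB|mg B mB].
  by rewrite setTI; apply: sub_sigma_algebra; exact: mg.
have := mg measurableT B mB; rewrite setTI.
by rewrite -[X in X -> _]/(<<s S >> _) sigma_algebra_id.
Qed.

Lemma meas_wrtS (S S' : set (set T)) (g : T -> R) : S `<=` S' ->
  meas_wrt S g -> meas_wrt S' g.
Proof. by move=> SS' mg B mB; apply: SS'; exact: mg. Qed.

Lemma meas_wrt_fun (S : set (set T)) (g : T -> R) : S `<=` measurable ->
  meas_wrt S g -> measurable_fun setT g.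
Proof. by move=> SM mg _ B mB; rewrite setTI; apply: SM; exact: mg. Qed.

(** On [D] the difference [f - g] is positive while its integral is at most 0, so [D] is null.
    Finiteness of the integral of [g] allows it to be cancelled. *)
Lemma integral_le_ae_le (f g : T -> R) :
  measurable_fun setT f -> measurable_fun setT g ->
  (forall x, 0 <= f x) -> (forall x, 0 <= g x) ->
  (\int[P]_(x in [set x | (g x < f x)%R]) (f x)%:E <=
   \int[P]_(x in [set x | (g x < f x)%R]) (g x)%:E)%E ->
  (\int[P]_(x in [set x | (g x < f x)%R]) (g x)%:E < +oo)%E ->
  P [set x | (g x < f x)%R] = 0%E.
Proof.
move=> mf mg f0 g0.
set D := [set x | _].
have mD : measurable D.
  rewrite (_ : D = (fun x => g x < f x) @^-1` [set true]).
    by rewrite -[X in measurable X]setTI; exact: measurable_fun_ltr.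
  by apply/seteqP; split=> x.
move=> fg goo.
have mfD : measurable_fun D f by exact: measurable_funTS.
have mgD : measurable_fun D g by exact: measurable_funTS.
have E : (\int[P]_(x in D) (f x)%:E = \int[P]_(x in D) (g x)%:E +
    \int[P]_(x in D) (f x - g x)%:E)%E.
  rewrite -ge0_integralD//.
  - by apply: eq_integral => x _; rewrite -EFinD addrC subrK.
  - by move=> x _; rewrite lee_fin.
  - exact/measurable_EFinP.
  - by move=> x /ltW; rewrite lee_fin subr_ge0.
  - by apply/measurable_EFinP; exact: measurable_funB.
have gfin : (\int[P]_(x in D) (g x)%:E)%E \is a fin_num.
  by rewrite ge0_fin_numE// integral_ge0// => x _; rewrite lee_fin.
have I0 : (\int[P]_(x in D) (f x - g x)%:E = 0)%E.
  apply/eqP; rewrite eq_le; apply/andP; split; last first.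
    by apply: integral_ge0 => x /ltW; rewrite lee_fin subr_ge0.
  by rewrite -(leeD2lE _ _ gfin) -E adde0.
have /(ae_eq_integral_abs P mD (f := fun x => (f x - g x)%:E)) :
    measurable_fun D (fun x => (f x - g x)%:E).
  by apply/measurable_EFinP; exact: measurable_funB.
rewrite (_ : (\int[P]_(x in D) `|(f x - g x)%:E|)%E = 0%E); last first.
  rewrite -I0; apply: eq_integral => x; rewrite inE => /ltW Dx.
  by rewrite gee0_abs// lee_fin subr_ge0.
move=> [/(_ erefl) h _].
apply/(negligibleP P mD); apply: negligibleS h => x Dx /= /(_ Dx) [].
by move=> /eqP; rewrite subr_eq0 => /eqP fgx; move: Dx; rewrite /D /= fgx ltxx.
Qed.

(** The restriction of [P] to [A] has density [\1_A]; the Radon-Nikodym change of variables carries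
    this to every nonnegative [k]. *)
Lemma ge0_integral_mrestr (A : set T) (mA : measurable A) (k : T -> R) :
  measurable_fun setT k -> (forall x, 0 <= k x) ->
  (\int[mrestr P mA]_x (k x)%:E = \int[P]_(x in A) (k x)%:E)%E.
Proof.
move=> mk k0.
pose nu : {finite_measure set T -> \bar R} := mrestr P mA.
have nuP : nu `<< P.
  apply/null_content_dominatesP => B mB PB0; apply/eqP.
  rewrite eq_le measure_ge0 andbT -PB0; apply: le_measure; rewrite ?inE//.
  exact: measurableI.
have kE0 x : (0 <= (k x)%:E)%E by rewrite lee_fin.
have mkE : measurable_fun setT (EFin \o k) by exact/measurable_EFinP.
rewrite -(Radon_Nikodym_SigmaFinite.change_of_variables nuP kE0 measurableT mkE).
rewrite [RHS]integral_mkcond.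
have mind : measurable_fun setT (fun x : T => (\1_A x : R)%:E).
  by apply/measurable_EFinP; exact: measurable_indic.
have fint := Radon_Nikodym_SigmaFinite.f_integrable nuP.
have fA : ae_eq P setT (Radon_Nikodym_SigmaFinite.f nu P) (fun x => (\1_A x)%:E).
  apply: integral_ae_eq => //.
  move=> E _ mE; rewrite -(Radon_Nikodym_SigmaFinite.f_integral nuP)//.
  by rewrite integral_indic// setIC.
have mkA : measurable_fun setT ((EFin \o k) \_ A).
  by apply/(measurable_restrictT _ _).1 => //; exact: measurable_funTS.
apply: ae_eq_integral => //.
  apply: emeasurable_funM => //; exact: measurable_int fint.
apply: filterS fA => x /= /(_ I) fx _; rewrite fx// patchE indicE.
by case: ifPn => _; rewrite ?mule1 ?mule0.
Qed.

End conditional_probability.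

Section trace_measure.
Context {R : realType} {d : measure_display} {T : measurableType d}.
Variables (P : probability T R) (S : set (set T)).
Hypotheses (hS : sigma_algebra setT S) (SM : S `<=` measurable).
Variables (A : set T) (mA : measurable A).

Let TS : measurableType _ := g_sigma_algebraType S.

(* The proof arguments are not used by the body; they allow the instances
   below to be inferred. *)
Definition trace_measure of sigma_algebra setT S & S `<=` measurable & measurable A :=
  fun B : set TS => P (B `&` A).

Local Notation nu := (trace_measure hS SM mA).

Lemma g_sigma_id (B : set TS) : measurable B -> S B.
Proof. by rewrite -[X in X -> _]/(<<s S >> _) sigma_algebra_id. Qed.

Let nu0 : nu set0 = 0%E. Proof. by rewrite /trace_measure set0I measure0. Qed.

Let nu_ge0 B : (0 <= nu B)%E. Proof. exact: measure_ge0. Qed.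

Let nu_sigma_additive : semi_sigma_additive nu.
Proof.
move=> F mF tF mUF; rewrite /trace_measure setI_bigcupl.
apply: measure_semi_sigma_additive.
- by move=> n; apply: measurableI => //; apply: SM; exact: g_sigma_id.
- exact: trivIset_setIr.
- by rewrite -setI_bigcupl; apply: measurableI => //; apply: SM; exact: g_sigma_id.
Qed.

HB.instance Definition _ := isMeasure.Build _ _ _ nu nu0 nu_ge0 nu_sigma_additive.

Let nu_fin : fin_num_fun nu.
Proof.
move=> B mB; rewrite fin_num_measure//; apply: measurableI => //.
by apply: SM; exact: g_sigma_id.
Qed.

HB.instance Definition _ := @Measure_isFinite.Build _ TS R nu nu_fin.

End trace_measure.

Section conditional_probability_ex.
Context {R : realType} {d : measure_display} {T : measurableType d}.
Variables (P : probability T R) (S : set (set T)).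
Hypotheses (hS : sigma_algebra setT S) (SM : S `<=` measurable).

Let TS : measurableType _ := g_sigma_algebraType S.

Let measTS (A : set T) : S A -> measurable (A : set TS).
Proof. by move=> SA; exact: sub_sigma_algebra. Qed.

Let TSmeas (A : set TS) : measurable A -> S A.
Proof. exact: g_sigma_id. Qed.

(** The identity as a measurable map to the coarser space: it pushes [mrestr P mA] forward to the
    trace measure. *)
Let idTS (x : T) : TS := x.

Let midTS : measurable_fun setT idTS.
Proof. by move=> _ B mB; rewrite setTI; apply: SM; exact: TSmeas. Qed.

Let trace_pushforward (A : set T) (mA : measurable A) (f : TS -> \bar R) (C : set TS) :
  measurable C -> measurable_fun (C : set TS) f -> (forall x, 0 <= f x)%E ->
  (\int[trace_measure P hS SM mA]_(x in C) f x = \int[mrestr P mA]_(x in C) f x)%E.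
Proof.
move=> mC mf f0.
by rewrite -(ge0_integral_pushforward midTS (mrestr P mA) mC mf).
Qed.

Let mrestrT : mrestr P measurableT = P :> (set T -> \bar R).
Proof. by apply/funext => B; rewrite /mrestr setIT. Qed.

(** [g] is the density of the trace of [P] on [A] with respect to the trace of [P], truncated at 1.
    The last clause lets one conditional probability be integrated against another. *)
Lemma cond_prob_ex (A : set T) : measurable A -> exists g : T -> R,
  [/\ meas_wrt S g, (forall x, 0 <= g x <= 1),
      (forall C, S C -> (\int[P]_(x in C) (g x)%:E = P (A `&` C))%E) &
      (forall k : T -> R, meas_wrt S k -> (forall x, 0 <= k x) ->
        (\int[P]_(x in A) (k x)%:E = \int[P]_x (k x * g x)%:E)%E)].
Proof.
move=> mA.
pose mu := trace_measure P hS SM measurableT.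
pose nu := trace_measure P hS SM mA.
have numu : nu `<< mu.
  apply/null_content_dominatesP => B mB muB0; apply/eqP; rewrite eq_le measure_ge0 andbT.
  have PB0 : P (B : set T) = 0%E by move: muB0; rewrite -[LHS]/(P (B `&` setT)) setIT.
  have mB' : measurable (B : set T) by apply: SM; exact: TSmeas.
  rewrite -PB0; apply: (@le_measure _ _ _ P (B `&` A) B); rewrite ?inE//.
  exact: measurableI.
pose f := Radon_Nikodym_SigmaFinite.f nu mu.
have f0 := Radon_Nikodym_SigmaFinite.f_ge0 numu.
have ffin := Radon_Nikodym_SigmaFinite.f_fin_num numu.
have fint := Radon_Nikodym_SigmaFinite.f_integrable numu.
have fE := Radon_Nikodym_SigmaFinite.f_integral numu.
have fcov := Radon_Nikodym_SigmaFinite.change_of_variables numu.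
pose h (x : T) : R := fine (f x).
have hE (x : T) : (h x)%:E = f x by rewrite /h fineK//; exact: ffin.
have h0 (x : T) : 0 <= h x by rewrite -lee_fin hE; exact: f0.
have mhTS : measurable_fun (setT : set TS) h.
  apply/measurable_EFinP.
  rewrite (_ : EFin \o h = f); last by apply/funext => x /=.
  exact: measurable_int fint.
have mh : meas_wrt S h by apply/meas_wrtP.
have hC C : S C -> (\int[P]_(x in C) (h x)%:E = P (A `&` C))%E.
  move=> SC.
  have := fE C (measTS SC).
  rewrite [X in X = _ -> _](_ : _ = P (A `&` C)); last by rewrite setIC.
  move=> ->; rewrite trace_pushforward//.
  - by rewrite mrestrT; apply: eq_integral => x _ /=; rewrite hE.
  - exact: measTS.
  - exact: measurable_funTS (measurable_int _ fint).
(* Over [D] the density integrates to at most [P D]; hence [h <= 1] almost everywhere and truncation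
   changes no integral. *)
pose D := [set x : T | 1 < h x].
have SD : S D.
  have := mh `]1, +oo[%classic (measurable_itv _).
  by congr S; apply/seteqP; split=> x /=; rewrite in_itv/= andbT.
have mhT := meas_wrt_fun SM mh.
have D0 : P D = 0%E.
  have mD := SM SD.
  have I1 : (\int[P]_(x in D) (cst (1%R : R) x)%:E = P D)%E.
    by rewrite (integral_cst P mD (1%:E)) mul1e.
  apply: (integral_le_ae_le mhT (measurable_cst (1:R))) => //.
    rewrite I1 (hC _ SD); apply: le_measure; rewrite ?inE//.
    exact: measurableI.
  by rewrite I1 (le_lt_trans (probability_le1 _ mD))// ltry.
pose g x := Num.min (h x) 1.
have mg : meas_wrt S g.
  by apply/meas_wrtP => //; apply: measurable_minr => //; exact: measurable_cst.
have g01 x : 0 <= g x <= 1 by rewrite /g le_min h0 ler01 ge_min lexx orbT.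
have mgT := meas_wrt_fun SM mg.
have ghae : {ae P, forall x, g x = h x}.
  exists D; split => // [|x /= ghx]; first exact: SM.
  rewrite /D /= ltNge; apply/negP => h1; apply: ghx.
  by rewrite /g min_l.
exists g; split => //.
- move=> C SC; rewrite -(hC _ SC); apply: ge0_ae_eq_integral.
  + exact: SM.
  + by apply/measurable_EFinP; exact: measurable_funTS.
  + by apply/measurable_EFinP; exact: measurable_funTS.
  + by move=> x _; rewrite lee_fin; case/andP: (g01 x).
  + by move=> x _; rewrite lee_fin.
  + by apply: filterS ghae => x /= -> _.
- move=> k mk k0.
  have mkT := meas_wrt_fun SM mk.
  have mkTS : measurable_fun (setT : set TS) k by apply/meas_wrtP.
  have kE0 (x : TS) : (0 <= (k x)%:E)%E by rewrite lee_fin.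
  have mkE : measurable_fun (setT : set TS) (EFin \o k) by exact/measurable_EFinP.
  rewrite -(ge0_integral_mrestr P mA mkT k0).
  rewrite -(trace_pushforward mA measurableT mkE)//.
  rewrite -[LHS](fcov _ _ kE0 measurableT mkE).
  rewrite trace_pushforward//.
  + rewrite mrestrT; apply: ge0_ae_eq_integral => //.
    * rewrite (_ : (fun x => _) = EFin \o (k \* h)).
        by apply/measurable_EFinP; exact: measurable_funM.
      by apply/funext => x /=; rewrite EFinM hE.
    * by apply/measurable_EFinP; exact: measurable_funM.
    * by move=> x _ /=; rewrite mule_ge0// ?lee_fin//; exact: f0.
    * by move=> x _; rewrite lee_fin mulr_ge0//; case/andP: (g01 x).
    * by apply: filterS ghae => x /= -> _; rewrite EFinM hE.
  + by apply: emeasurable_funM => //; exact: measurable_int fint.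
  + by move=> x; rewrite mule_ge0//; exact: f0.
Qed.
End conditional_probability_ex.

(** * Predicates definable in a sigma-algebra *)

(* A wrapper rather than a definition: membership in a generated sigma-algebra
   unfolds to a product, which confuses [apply]. *)
Variant sdef {X : Type} (D : set X) (S : set (set X)) (P : X -> Prop) : Prop :=
  Sdef of S [set x | D x /\ P x].

Section definable_predicates.
Context {X : Type} (D : set X) (S : set (set X)).
Hypothesis hS : sigma_algebra D S.
Implicit Types P Q : X -> Prop.

Lemma sdef_ext P Q : (forall x, D x -> P x <-> Q x) -> sdef D S P -> sdef D S Q.
Proof.
move=> PQ [SP]; constructor; move: SP; congr S; apply/seteqP; split=> x [Dx] /=.
  by move/(PQ x Dx).
by move/(PQ x Dx).
Qed.

Lemma sdef_not P : sdef D S P -> sdef D S (fun x => ~ P x).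
Proof.
move=> [SP]; constructor.
have [_ SC _] := hS; have := SC _ SP; congr S; apply/seteqP; split=> x /=.
  by move=> [Dx nP]; split=> // Px; apply: nP.
by move=> [Dx nP]; split=> // -[].
Qed.

Lemma sdef_exn (P : nat -> X -> Prop) : (forall n, sdef D S (P n)) ->
  sdef D S (fun x => exists n, P n x).
Proof.
move=> SP; have [_ _ SU] := hS; constructor.
have SP' n : S [set x | D x /\ P n x] by case: (SP n).
have := SU _ SP'; congr S; apply/seteqP; split=> x /=.
  by move=> [n _ [Dx Px]]; split=> //; exists n.
by move=> [Dx [n Px]]; exists n.
Qed.

Lemma sdef_cst (p : Prop) : sdef D S (fun=> p).
Proof.
have [S0 SC _] := hS; constructor.
have [hp|hp] := pselect p.
  have := SC _ S0; congr S; apply/seteqP; split=> x /=; first by move=> [].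
  by move=> [Dx _]; split.
by move: S0; congr S; apply/seteqP; split=> x //= -[].
Qed.

Lemma sdef_ex {I : countType} (P : I -> X -> Prop) : (forall i, sdef D S (P i)) ->
  sdef D S (fun x => exists i, P i x).
Proof.
move=> SP.
pose P' n := if @unpickle I n is Some i then P i else fun=> False.
apply: (@sdef_ext (fun x => exists n, P' n x)) => [x Dx|].
  split=> [[n]|[i Pi]].
    by rewrite /P'; case: unpickle => // i Pi; exists i.
  by exists (pickle i); rewrite /P' pickleK.
apply: sdef_exn => n; rewrite /P'; case: unpickle => [i|]; first exact: SP.
exact: sdef_cst.
Qed.

Lemma sdef_all {I : countType} (P : I -> X -> Prop) : (forall i, sdef D S (P i)) ->
  sdef D S (fun x => forall i, P i x).
Proof.
move=> SP; apply: (@sdef_ext (fun x => ~ exists i, ~ P i x)) => [x _|].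
  split=> [h i|h [i]]; last by apply; exact: h.
  by apply: contrapT => nP; apply: h; exists i.
by apply: sdef_not; apply: sdef_ex => i; exact: sdef_not.
Qed.

Lemma sdef_or P Q : sdef D S P -> sdef D S Q -> sdef D S (fun x => P x \/ Q x).
Proof.
move=> SP SQ; apply: (@sdef_ext (fun x => exists b : bool, if b then P x else Q x)) => [x _|].
  by split=> [[[]]|[Px|Qx]]; [left|right|exists true|exists false].
by apply: sdef_ex => -[].
Qed.

Lemma sdef_and P Q : sdef D S P -> sdef D S Q -> sdef D S (fun x => P x /\ Q x).
Proof.
move=> SP SQ; apply: (@sdef_ext (fun x => forall b : bool, if b then P x else Q x)) => [x _|].
  by split=> [h|[Px Qx] []//]; split; [exact: (h true)|exact: (h false)].
by apply: sdef_all => -[].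
Qed.

Lemma sdef_imply P Q : sdef D S P -> sdef D S Q -> sdef D S (fun x => P x -> Q x).
Proof.
move=> SP SQ; apply: (@sdef_ext (fun x => ~ P x \/ Q x)) => [x _|].
  split=> [[]// |h]; have [Px|] := pselect (P x); last by left.
  by right; exact: h.
by apply: sdef_or => //; exact: sdef_not.
Qed.

(** The condition [p] does not depend on the point, so it may be assumed while [P] is treated.
    Typically it places a rational time where the filtration contains the event. *)
Lemma sdef_guard (p : Prop) P : (p -> sdef D S P) -> sdef D S (fun x => p /\ P x).
Proof.
move=> SP; have [hp|np] := pselect p.
  by apply: sdef_and; [exact: sdef_cst|exact: SP].
by apply: (@sdef_ext (fun=> False)) => [x _|]; [split=> // -[]|exact: sdef_cst].
Qed.

Lemma sdef_guard_imply (p : Prop) P : (p -> sdef D S P) -> sdef D S (fun x => p -> P x).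
Proof.
move=> SP; have [hp|np] := pselect p.
  by apply: (@sdef_ext P) => [x _|]; [split=> // h; exact: h|exact: SP].
by apply: (@sdef_ext (fun=> True)) => [x _|]; [split|exact: sdef_cst].
Qed.

Lemma sdef_borel {R : realType} (y : X -> R) :
  (forall c, sdef D S (fun x => c < y x)) ->
  forall B : set R, measurable B -> sdef D S (fun x => B (y x)).
Proof.
move=> hy B mB.
have : (RGenOInfty.G (R:=R)).-sigma.-measurable B.
  by rewrite -RGenOInfty.measurableE.
apply: (@smallest_sub _ (sigma_algebra setT) (RGenOInfty.G (R:=R))
  [set B : set R | sdef D S (fun x => B (y x))]).
- split.
  + exact: sdef_cst.
  + move=> A SA /=; apply: (sdef_ext _ (sdef_not SA)) => x _ /=.
    by split=> [nA|[]].
  + move=> A SA /=; apply: (sdef_ext _ (sdef_exn SA)) => x _ /=.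
    by split=> [[n An]|[n _ An]]; exists n.
- move=> _ [c ->] /=; apply: (sdef_ext _ (hy c)) => x _.
  by rewrite /= in_itv/= andbT.
Qed.

Lemma sdef_borel_lt {R : realType} (y : X -> R) :
  (forall c, sdef D S (fun x => y x < c)) ->
  forall B : set R, measurable B -> sdef D S (fun x => B (y x)).
Proof.
move=> hy; apply: sdef_borel => c.
apply: (@sdef_ext (fun x => ~ forall n : nat, y x < c + n.+1%:R^-1)) => [x _|].
  split=> [h|cy h].
    rewrite ltNge; apply/negP => yc; apply: h => n.
    by rewrite (le_lt_trans yc)// ltrDl invr_gt0.
  have yc0 : 0 < y x - c by rewrite subr_gt0.
  have := h (Num.truncn (y x - c)^-1); apply/negP; rewrite -leNgt -lerBrDl.
  rewrite invf_ple ?posrE//; exact/ltW/truncnS_gt.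
by apply: sdef_not; apply: sdef_all => n; exact: hy.
Qed.

(* [sup] of an empty or unbounded set is 0, hence the two cases. *)
Lemma sdef_sup {R : realType} (P : rat -> X -> Prop) : (forall c, sdef D S (P c)) ->
  forall B : set R, measurable B ->
    sdef D S (fun x => B (sup [set ratr c | c in [set c | P c x]])).
Proof.
move=> SP; apply: sdef_borel => a.
pose bnd x := (exists c, P c x) /\ exists M : nat, forall c, P c x -> (ratr c : R) <= M%:R.
have bndP x : bnd x <-> has_sup [set (ratr c : R) | c in [set c | P c x]].
  split=> [[[c Pc] [M hM]]|[[_ [c Pc _]] [M hM]]].
    by split; [exists (ratr c), c|exists M%:R => _ [c' Pc' <-]; exact: hM].
  split; first by exists c.
  exists `|Num.ceil M|%N => c' Pc'.
  apply: (@le_trans _ _ M); first by apply: hM; exists c'.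
  apply: le_trans (ceil_ge M) _.
  by rewrite natr_absz ler_int ler_norm.
have Sbnd : sdef D S bnd.
  apply: sdef_and; first exact: sdef_ex.
  apply: sdef_ex => M; apply: sdef_all => c; apply: sdef_imply => //.
  exact: sdef_cst.
apply: (@sdef_ext (fun x => (bnd x /\ exists c, a < ratr c /\ P c x) \/
    (~ bnd x /\ a < 0))) => [x _|].
  split=> [[[/bndP b [c [ac Pc]]]|[nb a0]]|asup].
  - by apply: lt_le_trans ac _; apply: ub_le_sup; [exact: b.2|exists c].
  - by rewrite sup_out// => /bndP.
  - have [b|nb] := pselect (bnd x); last first.
      by right; split=> //; rewrite sup_out// in asup => /bndP.
    left; split=> //; move/bndP: b => b.
    have [_ [c Pc <-] ac] := sup_gt b.1 asup.
    by exists c.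
apply: sdef_or; last by apply: sdef_and; [exact: sdef_not|exact: sdef_cst].
apply: sdef_and => //; apply: sdef_ex => c; apply: sdef_and => //.
exact: sdef_cst.
Qed.

End definable_predicates.

Lemma sdefT {X : Type} (S : set (set X)) (P : X -> Prop) :
  sdef setT S P <-> S [set x | P x].
Proof.
have e : [set x | [set: X] x /\ P x] = [set x | P x].
  by apply/seteqP; split=> x //= -[].
by split=> [[]|h]; [|constructor]; rewrite e.
Qed.

(** Rebuilds a real process from its rational level sets once each of these has been split. *)
Lemma rat_sup {R : realType} (y : R) : sup [set (ratr c : R) | c in [set c | ratr c < y]] = y.
Proof.
have ne : [set (ratr c : R) | c in [set c | ratr c < y]] !=set0.
  have y1 : y - 1 < y by rewrite ltrBlDr ltrDl.
  have [c] := rat_in_itvoo y1; rewrite in_itv/= => /andP[_ cy].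
  by exists (ratr c), c.
apply/eqP; rewrite eq_le; apply/andP; split.
  by apply: ge_sup => // _ [c /ltW cy <-].
rewrite leNgt; apply/negP => ltsy.
have [c] := rat_in_itvoo ltsy; rewrite in_itv/= => /andP[sc cy].
have : ratr c <= sup [set (ratr c : R) | c in [set c | ratr c < y]].
  by apply: ub_le_sup; [exists y => _ [c' /ltW cy' <-]|exists c].
by rewrite leNgt sc.
Qed.

(** * Monotone limits, almost everywhere comparison, cadlag paths *)

Section monotone_limits.
Context {R : realType} {d : measure_display} {T : measurableType d}.
Variable P : probability T R.

Lemma measure_bigcap_ge (x : \bar R) (E : nat -> set T) :
  (forall n, measurable (E n)) -> (forall n, E n.+1 `<=` E n) ->
  (forall n, (x <= P (E n))%E) -> (x <= P (\bigcap_n E n))%E.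
Proof.
move=> mE Edec xE.
have mI : measurable (\bigcap_n E n) by exact: bigcapT_measurable.
have c : P (E n) @[n --> \oo] --> P (\bigcap_n E n).
  apply: nonincreasing_cvg_mu => //.
    by rewrite (le_lt_trans (probability_le1 _ _))// ltry.
  by apply/nonincreasing_seqP => n; exact/subsetPset.
rewrite -(cvg_lim _ c)//; apply: lime_ge; first by apply/cvg_ex; eexists; exact: c.
exact: nearW.
Qed.

Lemma measure_bigcup_le (x : \bar R) (E : nat -> set T) :
  (forall n, measurable (E n)) -> (forall n, E n `<=` E n.+1) ->
  (forall n, (P (E n) <= x)%E) -> (P (\bigcup_n E n) <= x)%E.
Proof.
move=> mE Einc Ex.
have mI : measurable (\bigcup_n E n) by exact: bigcupT_measurable.
have c : P (E n) @[n --> \oo] --> P (\bigcup_n E n).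
  apply: nondecreasing_cvg_mu => //.
  by apply/nondecreasing_seqP => n; exact/subsetPset.
rewrite -(cvg_lim _ c)//; apply: lime_le; first by apply/cvg_ex; eexists; exact: c.
exact: nearW.
Qed.

Lemma ae_le_integral_le (f g : T -> R) (D : set T) : measurable D ->
  measurable_fun setT f -> measurable_fun setT g ->
  (forall x, 0 <= f x) -> (forall x, 0 <= g x) ->
  P.-negligible [set x | g x < f x] ->
  (\int[P]_(x in D) (f x)%:E <= \int[P]_(x in D) (g x)%:E)%E.
Proof.
move=> mD mf mg f0 g0 neg; apply: ae_ge0_le_integral => //.
- by move=> x _; rewrite lee_fin.
- by apply/measurable_EFinP; exact: measurable_funTS.
- by move=> x _; rewrite lee_fin.
- by apply/measurable_EFinP; exact: measurable_funTS.
- apply: negligibleS neg => x /= h; rewrite ltNge; apply/negP => fg.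
  by apply: h => _; rewrite lee_fin.
Qed.

Lemma negligible_ex {I : countType} (p : I -> T -> Prop) :
  (forall i, P.-negligible [set x | p i x]) -> P.-negligible [set x | exists i, p i x].
Proof.
move=> np.
pose E n := if @unpickle I n is Some i then [set x | p i x] else set0.
apply: (@negligibleS _ _ _ _ (\bigcup_n E n)).
  by move=> x [i pi]; exists (pickle i) => //; rewrite /E pickleK.
apply: negligible_bigcup => n; rewrite /E.
by case: unpickle => [i|]; [exact: np|exact: negligible_set0].
Qed.

Lemma negligible_guard (c : Prop) (p : T -> Prop) :
  (c -> P.-negligible [set x | p x]) -> P.-negligible [set x | c /\ p x].
Proof.
move=> h; have [hc|nc] := pselect c.
  by apply: negligibleS (h hc) => x [].
by apply: (@negligibleS _ _ _ _ set0) => [x []//|]; exact: negligible_set0.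
Qed.

End monotone_limits.

(** For increasing paths right-continuity reduces to its upper half, hence the one-sided second
    hypothesis; this form is what an infimum over later times yields directly. *)
Lemma mono_cadlag {R : realType} {T : Type} (X : R -> T -> R) :
  (forall w s t, s <= t -> X s w <= X t w) ->
  (forall w t c, X t w < c -> exists q, t < q /\ forall s, s < q -> X s w < c) ->
  cadlag X.
Proof.
move=> Xmono Xrc w t t0; split=> [|t_gt0].
  apply/cvgrPdist_lt => e e0.
  have [q [tq hq]] := Xrc w t (X t w + e) (ltr_pwDr e0 (lexx _)).
  near=> s; rewrite distrC ger0_norm ?subr_ge0.
    by rewrite ltrBlDl; apply: hq; near: s; exact: nbhs_right_lt.
  apply: Xmono; near: s; exact: nbhs_right_ge.
apply: nondecreasing_at_left_is_cvgr.
- by apply: nearW => x a b _ _; exact: Xmono.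
- apply: nearW => x; exists (X t w) => z [y yI <-].
  by move: yI; rewrite /= in_itv/= => /andP[_ /ltW]; exact: Xmono.
Unshelve. all: by end_near. Qed.

(** Turns [l * Y < X] into a level set of one cadlag process. *)
Lemma cadlag_subZ {R : realType} {T : Type} (X Y : R -> T -> R) (l : R) :
  cadlag X -> cadlag Y -> cadlag (fun t w => X t w - l * Y t w).
Proof.
move=> cX cY w t t0; have [X1 X2] := cX w t t0; have [Y1 Y2] := cY w t t0.
split=> [|tgt0]; first by apply: cvgB => //; exact: cvgMr.
apply: is_cvgB; first exact: X2.
by apply: is_cvgMr; exact: Y2.
Qed.

Lemma rat_between {R : realType} (x y : R) : x < y -> exists q : rat, x < ratr q < y.
Proof. by move=> /rat_in_itvoo[q]; rewrite in_itv/=; exists q. Qed.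

(** * Sets of small outer measure *)

Section small_sets.
Context {R : realType} {d : measure_display} {T : measurableType d}.
Variable P : probability T R.
Implicit Types (e : R) (D E : set T).

(** An outer bound, because the exceptional events quantify over uncountably many times and are not
    known to be measurable. *)
Definition small e D := exists E, [/\ measurable E, D `<=` E & (P E <= e%:E)%E].

Lemma smallS e D E : D `<=` E -> small e E -> small e D.
Proof. by move=> DE [B [mB EB PB]]; exists B; split=> //; exact: subset_trans EB. Qed.

Lemma small_le e e' D : e <= e' -> small e D -> small e' D.
Proof.
by move=> ee' [B [mB EB PB]]; exists B; split=> //; rewrite (le_trans PB)// lee_fin.
Qed.

Lemma smallU e e' D E : small e D -> small e' E -> small (e + e') (D `|` E).
Proof.
move=> [B [mB DB PB]] [C [mC EC PC]]; exists (B `|` C); split.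
- exact: measurableU.
- exact: setUSS.
- rewrite EFinD; apply: (le_trans (measureU2 _ _ _)) => //; exact: leeD.
Qed.

(** The tail intersections increase and each lies inside a single [B n], so a uniform bound passes
    to their union without any decay. *)
Lemma small_liminf e (D : nat -> set T) : (forall n, small e (D n)) ->
  small e [set w | exists N, forall n, (N <= n)%N -> D n w].
Proof.
move=> /choice[B hB].
exists (\bigcup_N \bigcap_(n in [set n | (N <= n)%N]) B n).
have mI N : measurable (\bigcap_(n in [set n | (N <= n)%N]) B n).
  by apply: bigcap_measurable => // [|n _]; [exists N => /=|case: (hB n)].
split.
- exact: bigcupT_measurable.
- move=> w [N hN]; exists N => // n Nn; have [_ + _] := hB n; apply; exact: hN.
- apply: measure_bigcup_le => // [N|N].
    by move=> w h n /= Nn; apply: h => /=; exact: ltnW.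
  have [mB _] := hB N; apply: le_trans; apply: le_measure; rewrite ?inE//.
  by move=> w; apply => /=.
Qed.

Lemma small_incr e (D : nat -> set T) : (forall n, small e (D n)) ->
  (forall m n w, (m <= n)%N -> D m w -> D n w) -> small e [set w | exists n, D n w].
Proof.
move=> sD Dinc; apply: smallS (small_liminf sD) => w [n Dn].
by exists n => m nm; exact: Dinc Dn.
Qed.

Lemma small_negligible D : (forall e, 0 < e -> small e D) -> P.-negligible D.
Proof.
move=> sD.
have /choice[B hB] : forall n : nat, exists B,
    [/\ measurable B, D `<=` B & (P B <= (n.+1%:R^-1)%:E)%E].
  by move=> n; apply: sD; rewrite invr_gt0.
have mI : measurable (\bigcap_n B n) by apply: bigcapT_measurable => n; case: (hB n).
exists (\bigcap_n B n); split=> //; last by move=> w Dw n _; have [_ + _] := hB n; apply.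
apply/eqP; rewrite eq_le measure_ge0 andbT; apply/lee_addgt0Pr => e e0.
have [mB _ PB] := hB (Num.truncn e^-1); rewrite add0e.
apply: (@le_trans _ _ (P (B (Num.truncn e^-1)))).
  by apply: le_measure; rewrite ?inE// => w; apply.
apply: le_trans PB _; rewrite lee_fin invf_ple ?posrE//; exact/ltW/truncnS_gt.
Qed.

(** Borel-Cantelli for outer bounds; [c] and [K0] leave room for estimates valid from some index
    on. *)
Lemma small_limsup (c : R) (K0 : nat) (D : nat -> set T) : 0 <= c ->
  (forall k, (K0 <= k)%N -> small (c * 2^-1 ^+ k) (D k)) ->
  P.-negligible [set w | forall K, exists k, (K <= k)%N /\ D k w].
Proof.
move=> c0 sD.
(* The bound is the exact sum of [c * 2^-1 ^+ k] over [K <= k < K + n], so the induction closes by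
   an identity. *)
have step K n : (K0 <= K)%N ->
    small (2 * c * 2^-1 ^+ K - 2 * c * 2^-1 ^+ (K + n))
      [set w | exists k, (K <= k < K + n)%N /\ D k w].
  move=> K0K; elim: n => [|n IH].
    rewrite addn0 subrr; exists set0; split=> //; last by rewrite measure0.
    by move=> w [k [/andP[Kk]]]; rewrite ltnNge Kk.
  have -> : 2 * c * 2^-1 ^+ K - 2 * c * 2^-1 ^+ (K + n.+1) =
      (2 * c * 2^-1 ^+ K - 2 * c * 2^-1 ^+ (K + n)) + c * 2^-1 ^+ (K + n).
    by rewrite addnS exprS; lra.
  apply: smallS (smallU IH (sD (K + n)%N (leq_trans K0K (leq_addr _ _)))).
  move=> w [k [/andP[Kk]]]; rewrite addnS ltnS leq_eqVlt => /orP[/eqP->|kn] Dk.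
    by right.
  by left; exists k; rewrite Kk kn.
have tail K : (K0 <= K)%N -> small (2 * c * 2^-1 ^+ K)
    [set w | exists k, (K <= k)%N /\ D k w].
  move=> K0K.
  have sm n : small (2 * c * 2^-1 ^+ K) [set w | exists k, (K <= k < K + n)%N /\ D k w].
    apply: small_le (step K n K0K); rewrite lerBlDr lerDl mulr_ge0 ?mulr_ge0//.
  apply: smallS (small_incr sm _) => [w [k [Kk Dk]]|m n w mn [k [/andP[Kk km] Dk]]].
    exists k.+1, k; split=> //; rewrite Kk addnS ltnS leq_addl//.
  exists k; split=> //; rewrite Kk (leq_trans km)// leq_add2l//.
apply: small_negligible => e e0.
have [K K0K Ke] : exists2 K, (K0 <= K)%N & 2 * c * 2^-1 ^+ K <= e.
  have h : (fun n => 2 * c * 2^-1 ^+ n) @ \oo --> (2 * c * 0 : R).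
    apply: cvgMr; apply: cvg_expr.
    by rewrite ger0_norm ?invr_ge0// invf_lt1// ltr1n.
  move/cvgrPdist_lt/(_ _ e0): h => [N _ hN].
  exists (maxn K0 N); first exact: leq_maxl.
  have := hN _ (leq_maxr K0 N : [set n | (N <= n)%N] _) => /=.
  rewrite mulr0 sub0r normrN => /ltW; apply: le_trans; exact: ler_norm.
by apply: small_le Ke _; apply: smallS (tail K K0K) => w /(_ K).
Qed.

Lemma fiber_le {I : finType} (c : T -> I) (X Y : set T) (k : R) : 0 <= k ->
  (forall i, measurable (c @^-1` [set i])) -> measurable X -> measurable Y ->
  (forall i, P (X `&` c @^-1` [set i]) <= k%:E * P (Y `&` c @^-1` [set i]))%E ->
  (P X <= k%:E * P Y)%E.
Proof.
move=> k0 mc mX mY h.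
have split_ Z : measurable Z -> (P Z = \sum_(i \in [set: I]) P (Z `&` c @^-1` [set i]))%E.
  move=> mZ; rewrite -measure_fin_bigcup//.
  - by congr (P _); apply/seteqP; split=> [w Zw|w [i _ []//]]; exists (c w).
  - exact: finite_finset.
  - by move=> i j _ _ [w [[_ /= <-] [_ /= <-]]].
  - by move=> i _; apply: measurableI.
rewrite (split_ _ mX) (split_ _ mY) ge0_mule_fsumr//.
by apply: lee_fsum => [|i _]; [exact: finite_finset|exact: h].
Qed.

Variable S : set (set T).
Hypotheses (hS : sigma_algebra setT S) (SM : S `<=` measurable).

(* Split [C] along [D t] for the largest time [t]: on [D t] the event is
   contained in [U t], off [D t] the time [t] is irrelevant. *)
Lemma maximal_sorted (U D : R -> set T) (B0 : set T) (k : R) (s : seq R) : 0 <= k ->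
  measurable B0 -> sorted >=%O s ->
  (forall t, t \in s -> measurable (U t)) -> (forall t, t \in s -> S (D t)) ->
  (forall u t, u \in s -> t \in s -> u <= t -> U u `<=` U t) ->
  (forall t C, t \in s -> S C -> C `<=` D t -> (P (U t `&` C) <= k%:E * P (C `&` B0))%E) ->
  forall C, S C ->
    measurable (C `&` [set w | exists2 t, t \in s & U t w /\ D t w]) /\
    (P (C `&` [set w | exists2 t, t \in s & U t w /\ D t w]) <= k%:E * P (C `&` B0))%E.
Proof.
move=> k0 mB0; elim: s => [|t s IH] srt mU SD Umono h C SC.
  rewrite (_ : [set w | _] = set0) ?setI0 ?measure0; last by apply/seteqP; split=> w // [].
  by split=> //; rewrite mule_ge0.
have tmax u : u \in s -> u <= t.
  move: srt => /=; rewrite path_sortedE; last by move=> x y z xy yz; exact: le_trans yz xy.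
  by move=> /andP[/allP h' _] /h'.
have ts : t \in t :: s by rewrite mem_head.
have ss u : u \in s -> u \in t :: s by rewrite in_cons orbC => ->.
have SCD : S (C `&` D t).
  by apply/(sdefT S (C `&` D t)); apply: sdef_and => //; apply/sdefT => //; exact: SD.
have SCnD : S (C `\` D t).
  apply/(sdefT S (C `\` D t)); apply: sdef_and => //; first exact/sdefT.
  by apply: sdef_not => //; apply/sdefT; exact: SD.
have srt' : sorted >=%O s by exact: path_sorted srt.
have [mE PE] := IH srt' (fun u us => mU u (ss u us)) (fun u us => SD u (ss u us))
  (fun u v us vs => Umono u v (ss u us) (ss v vs)) (fun u C' us => h u C' (ss u us)) _ SCnD.
have P1 := h t _ ts SCD (@subIsetr _ _ _).
have mUC : measurable (U t `&` (C `&` D t)).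
  by apply: measurableI; [exact: mU|exact: SM].
have E : C `&` [set w | exists2 u, u \in t :: s & U u w /\ D u w] =
  (U t `&` (C `&` D t)) `|`
  ((C `\` D t) `&` [set w | exists2 u, u \in s & U u w /\ D u w]).
  apply/seteqP; split=> w /=.
    move=> [Cw [u us [Uu Du]]].
    have [Dt|nDt] := pselect (D t w).
      left; split=> //; apply: Umono Uu => //.
      by move: us; rewrite in_cons => /orP[/eqP->|/tmax].
    right; split=> //; exists u => //; move: us; rewrite in_cons => /orP[/eqP ut|//].
    by case: nDt; rewrite -ut.
  move=> [[Ut [Cw Dt]]|[[Cw _] [u us UD]]]; split=> //; first by exists t.
  by exists u => //; exact: ss.
rewrite E; split; first exact: measurableU.
apply: (le_trans (measureU2 _ _ _)) => //.
apply: (le_trans (leeD P1 PE)).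
have mCB : measurable (C `&` D t `&` B0) by apply: measurableI => //; exact: SM.
have mCnB : measurable ((C `\` D t) `&` B0) by apply: measurableI => //; exact: SM.
rewrite -ge0_muleDr// -measureU//.
- rewrite le_eqVlt; apply/orP; left; apply/eqP; congr (_ * P _)%E.
  apply/seteqP; split=> w /=; first by move=> [[[]]|[[]]].
  by move=> [Cw Bw]; have [Dt|nDt] := pselect (D t w); [left|right].
- by apply/seteqP; split=> w //= [[[_ Dt] _] [[_ nD] _]].
Qed.

(** The event depends only on the set of times, so the list may be sorted in decreasing order. *)
Lemma maximal_seq (U D : R -> set T) (B0 : set T) (k : R) (s : seq R) : 0 <= k ->
  measurable B0 ->
  (forall t, t \in s -> measurable (U t)) -> (forall t, t \in s -> S (D t)) ->
  (forall u t, u \in s -> t \in s -> u <= t -> U u `<=` U t) ->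
  (forall t C, t \in s -> S C -> C `<=` D t -> (P (U t `&` C) <= k%:E * P (C `&` B0))%E) ->
  forall C, S C ->
    measurable (C `&` [set w | exists2 t, t \in s & U t w /\ D t w]) /\
    (P (C `&` [set w | exists2 t, t \in s & U t w /\ D t w]) <= k%:E * P (C `&` B0))%E.
Proof.
move=> k0 mB0 mU SD Umono h C SC.
rewrite (_ : [set w | exists2 t, t \in s & _] =
  [set w | exists2 t, t \in sort >=%O s & U t w /\ D t w]); last first.
  by apply/seteqP; split=> w /= [t ts UD]; exists t => //; rewrite mem_sort in ts *.
apply: maximal_sorted => //.
- by apply: sort_sorted => x y; exact: le_total.
- by move=> t; rewrite mem_sort; exact: mU.
- by move=> t; rewrite mem_sort; exact: SD.
- by move=> u t; rewrite !mem_sort; exact: Umono.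
- by move=> t C'; rewrite mem_sort; exact: h.
Qed.

End small_sets.

(** * Finite partitions generating the Borel sets *)

Section cells.
Context {R : realType}.

(** Indices that encode no rational are sent to 0, which only repeats a cut point already
    present. *)
Definition qn (k : nat) : R := if @unpickle rat k is Some r then ratr r else 0.

Lemma qn_ratr (r : rat) : qn (pickle r) = ratr r.
Proof. by rewrite /qn pickleK. Qed.

(** The code of the atom containing [x] in the partition cut out by the first [n] values of [qn];
    these partitions become finer with [n]. *)
Definition cell (n : nat) (x : \bar R) : n.-tuple bool :=
  [tuple (x < (qn k)%:E)%E | k < n].

Lemma cell_measurable n i : measurable [set x : \bar R | cell n x = i].
Proof.
have sM : sigma_algebra setT (@measurable _ (\bar R)) by exact: sigma_algebra_measurable.
apply/sdefT; apply: (@sdef_ext _ _ _ (fun x : \bar R => forall k : 'I_n,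
    (x < (qn k)%:E)%E = tnth i k)) => [x _|].
  split=> [h|<- k]; last by rewrite tnth_mktuple.
  by apply: eq_from_tnth => k; rewrite tnth_mktuple.
apply: sdef_all => // k.
have lt : sdef setT measurable (fun x : \bar R => (x < (qn k)%:E)%E).
  apply/sdefT; rewrite (_ : [set x | _] = `]-oo, (qn k)%:E[%classic).
    exact: emeasurable_itv.
  by apply/seteqP; split=> x /=; rewrite in_itv.
case: (tnth i k); first exact: lt.
apply: (sdef_ext _ (sdef_not sM lt)) => x _; split=> [/negP/negbTE//|-> //].
Qed.

(** A ray with real endpoint is a countable union of rays with rational endpoint, so good-sets
    arguments on [tau] need only the rays that define the cells. *)
Lemma ereal_rays_ind (K : set (set (\bar R))) : sigma_algebra setT K ->
  (forall k, K [set x | (x < (qn k)%:E)%E]) -> measurable `<=` K.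
Proof.
move=> sK hK B mB.
have : (ErealGenInftyO.G (R:=R)).-sigma.-measurable B by rewrite -ErealGenInftyO.measurableE.
apply: smallest_sub => // _ [x ->].
have : K [set y | (y < x%:E)%E].
  apply/sdefT; apply: (@sdef_ext _ _ _ (fun y : \bar R => exists k : nat,
      qn k <= x /\ (y < (qn k)%:E)%E)) => [y _|].
    split=> [[k [kx yk]]|]; first by rewrite (lt_le_trans yk)// lee_fin.
    case: y => [y| |].
    - rewrite lte_fin => /rat_between[q /andP[yq qx]].
      by exists (pickle q); rewrite qn_ratr lte_fin yq ltW.
    - by rewrite ltNge leey.
    - move=> _; have x1 : x - 1 < x by rewrite ltrBlDr ltrDl.
      have [q /andP[_ qx]] := rat_between x1.
      by exists (pickle q); rewrite qn_ratr ltW// ltNyr.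
  by apply: sdef_ex => // k; apply: sdef_guard => // _; apply/sdefT.
by congr K; apply/seteqP; split=> y /=; rewrite in_itv.
Qed.

End cells.

(** * The filtrations *)

Section setting.
Context {R : realType} {d : measure_display} {Omega : measurableType d}.
Variables (Q : probability Omega R) (F : R -> set (set Omega)) (tau : Omega -> \bar R).
Hypotheses (hF : is_filtration F) (hFrc : right_continuous_filtration F)
  (htau_meas : measurable_fun setT tau)
  (htau_pos : forall w, (0 <= tau w)%E).

Local Notation Finf := (infty_sa F).
Local Notation J := (join (sigma_of tau) (infty_sa F)).
Local Notation G := (Gfilt Q F tau).
Local Notation TG := (g_sigma_algebraType (Ginf_gen Q F tau)).

Implicit Types s t : R.

(* [G t] is [Cfilt t] augmented by the null sets. *)
Definition Cfilt (t : R) : set (set Omega) :=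
  \bigcap_(s in `]t, +oo[%classic)
    join (F s) (sigma_of (fun w => Order.min (tau w) s%:E)).

Lemma sigma_F t : 0 <= t -> sigma_algebra setT (F t).
Proof. by move=> t0; exact: (hF.1 t t0).1. Qed.

Lemma F_meas t : 0 <= t -> F t `<=` measurable.
Proof. by move=> t0; exact: (hF.1 t t0).2. Qed.

Lemma F_mono s t : 0 <= s -> s <= t -> F s `<=` F t.
Proof. exact: hF.2. Qed.

Lemma F_Finf t : 0 <= t -> F t `<=` Finf.
Proof.
move=> t0 A FA; apply: sub_sigma_algebra; exists t => //=.
by rewrite in_itv/= andbT.
Qed.

Lemma Finf_J : Finf `<=` J.
Proof. by move=> A FA; apply: sub_sigma_algebra; right. Qed.

Lemma sigma_join (S1 S2 : set (set Omega)) : sigma_algebra setT (join S1 S2).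
Proof. exact: smallest_sigma_algebra. Qed.

Lemma sigma_Finf : sigma_algebra setT Finf.
Proof. exact: smallest_sigma_algebra. Qed.

Lemma joinS (S1 S2 S : set (set Omega)) : sigma_algebra setT S -> S1 `<=` S -> S2 `<=` S ->
  join S1 S2 `<=` S.
Proof. by move=> sS S1S S2S; apply: smallest_sub => // A [/S1S|/S2S]. Qed.

Lemma J_meas : J `<=` measurable.
Proof.
apply: joinS; first exact: sigma_algebra_measurable.
- move=> _ [B mB <-]; rewrite -[X in measurable X]setTI; exact: htau_meas.
- apply: smallest_sub; first exact: sigma_algebra_measurable.
  by move=> A [t /=]; rewrite in_itv/= andbT => t0; exact: F_meas.
Qed.

Lemma tau_J (B : set (\bar R)) : measurable B -> J (tau @^-1` B).
Proof. by move=> mB; apply: sub_sigma_algebra; left; exists B. Qed.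

Lemma join_min_J s : 0 <= s ->
  join (F s) (sigma_of (fun w => Order.min (tau w) s%:E)) `<=` J.
Proof.
move=> s0; apply: joinS; first exact: sigma_join.
  by move=> A FA; apply: Finf_J; exact: F_Finf FA.
move=> _ [B mB <-].
apply: (@tau_J ((fun x : \bar R => Order.min x s%:E) @^-1` B)).
rewrite -[X in measurable X]setTI.
have : measurable_fun setT (fun x : \bar R => Order.min x s%:E).
  by apply: measurable_mine => //; exact: measurable_cst.
by apply.
Qed.

Lemma sigma_Cfilt t : sigma_algebra setT (Cfilt t).
Proof. by apply: sigma_algebra_bigcap => s _; exact: sigma_join. Qed.

Lemma CfiltE t A : Cfilt t A <-> forall s, t < s ->
  join (F s) (sigma_of (fun w => Order.min (tau w) s%:E)) A.
Proof.
split=> [h s ts|h s /=]; first by apply: h; rewrite /= in_itv/= andbT.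
by rewrite in_itv/= andbT; exact: h.
Qed.

Lemma Cfilt_J t : 0 <= t -> Cfilt t `<=` J.
Proof.
move=> t0 A /CfiltE/(_ (t + 1)); rewrite ltrDl ltr01 => /(_ isT).
by apply: join_min_J; rewrite addr_ge0.
Qed.

Lemma sigma_G t : sigma_algebra setT (G t).
Proof. exact: sigma_join. Qed.

Lemma Cfilt_G t : Cfilt t `<=` G t.
Proof. by move=> A CA; apply: sub_sigma_algebra; right. Qed.

Lemma F_Cfilt t : 0 <= t -> F t `<=` Cfilt t.
Proof.
move=> t0 A FA; apply/CfiltE => s ts; apply: sub_sigma_algebra; left.
by apply: F_mono FA => //; exact: ltW.
Qed.

Lemma F_G t : 0 <= t -> F t `<=` G t.
Proof. by move=> t0 A FA; apply: Cfilt_G; exact: F_Cfilt. Qed.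

Lemma G_mono s t : s <= t -> G s `<=` G t.
Proof.
move=> st; apply: joinS; first exact: sigma_G.
  by move=> A NA; apply: sub_sigma_algebra; left.
move=> A CA; apply: Cfilt_G; apply/CfiltE => u tu.
by move/CfiltE : CA; apply; exact: le_lt_trans tu.
Qed.

Lemma G_meas t : 0 <= t -> G t `<=` @measurable _ TG.
Proof.
move=> t0 A GA; apply: sub_sigma_algebra; exists t => //=.
by rewrite in_itv/= andbT.
Qed.

Lemma F_measG t : 0 <= t -> F t `<=` @measurable _ TG.
Proof. by move=> t0 A FA; apply: (G_meas t0); exact: F_G. Qed.

Lemma Finf_measG : Finf `<=` @measurable _ TG.
Proof.
apply: smallest_sub; first exact: smallest_sigma_algebra.
by move=> A [t /=]; rewrite in_itv/= andbT => t0; exact: F_measG.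
Qed.

(** For [s > t] the minimum of [tau] and [s] equals [tau] where [tau <= t] and exceeds [t]
    elsewhere, so the stopped variable decides the event. *)
Lemma tau_le_Cfilt t (B : set (\bar R)) : measurable B ->
  Cfilt t [set w | B (tau w) /\ (tau w <= t%:E)%E].
Proof.
move=> mB; apply/CfiltE => s ts; apply: sub_sigma_algebra; right.
exists (B `&` [set x | (x <= t%:E)%E]).
  apply: measurableI => //; rewrite (_ : [set x | _] = `]-oo, t%:E]%classic).
    exact: emeasurable_itv.
  by apply/seteqP; split=> x /=; rewrite in_itv.
apply/seteqP; split=> w /=; rewrite /Order.min; case: ltP => //.
- by move=> _ [Bs]; rewrite lee_fin leNgt ts.
- by move=> stw [Bt] /(le_trans stw); rewrite lee_fin leNgt ts.
Qed.

(** Only stopped copies of [tau] are available: finite values are reached through [tau <= n], and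
    the value [+oo] as a complement. *)
Lemma tau_measG (B : set (\bar R)) : measurable B -> @measurable _ TG (tau @^-1` B).
Proof.
move=> mB.
have mle n (B' : set (\bar R)) : measurable B' ->
    @measurable _ TG [set w | B' (tau w) /\ (tau w <= (n%:R : R)%:E)%E].
  by move=> mB'; apply: (@G_meas n%:R) => //; apply: Cfilt_G; exact: tau_le_Cfilt.
have finU (B' : set (\bar R)) : measurable B' ->
    @measurable _ TG [set w | B' (tau w) /\ (tau w < +oo)%E].
  move=> mB'; rewrite (_ : [set w | _] =
      \bigcup_n [set w | B' (tau w) /\ (tau w <= (n%:R : R)%:E)%E]).
    by apply: bigcupT_measurable => n; exact: mle.
  apply/seteqP; split=> w /=.
    move=> [Bw twoo].
    have tfin : tau w \is a fin_num by rewrite ge0_fin_numE.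
    exists (Num.truncn (fine (tau w))).+1 => //=; split=> //.
    by rewrite -(fineK tfin) lee_fin ltW// truncnS_gt.
  by move=> [n _ /= [Bw tn]]; split=> //; rewrite (le_lt_trans tn)// ltry.
have [Boo|nBoo] := pselect (B +oo%E).
  rewrite (_ : tau @^-1` B = [set w | B (tau w) /\ (tau w < +oo)%E] `|`
      ~` [set w | setT (tau w) /\ (tau w < +oo)%E]).
    by apply: measurableU; [exact: finU|apply: measurableC; exact: finU].
  apply/seteqP; split=> w /=.
    move=> Bw; have [|tw] := ltP (tau w) +oo%E; [by left|right].
    by move=> [].
  move=> [[]//|nt]; suff -> : tau w = +oo%E by [].
  by apply/eqP; rewrite -leye_eq leNgt; apply/negP => ?; apply: nt.
rewrite (_ : tau @^-1` B = [set w | B (tau w) /\ (tau w < +oo)%E]); first exact: finU.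
apply/seteqP; split=> w /=; last by move=> [].
by move=> Bw; split=> //; rewrite ltey; apply/eqP => tw; rewrite tw in Bw.
Qed.

Lemma J_measG : J `<=` @measurable _ TG.
Proof.
apply: joinS; first exact: smallest_sigma_algebra; last exact: Finf_measG.
by move=> _ [B mB <-]; exact: tau_measG.
Qed.

Lemma J_null_bigcup (B : nat -> set Omega) : (forall k, J (B k)) ->
  (forall k, Q (B k) = 0%E) -> J (\bigcup_k B k) /\ Q (\bigcup_k B k) = 0%E.
Proof.
move=> JB QB; have [_ _ JU] := sigma_join (sigma_of tau) Finf.
have JUB : J (\bigcup_k B k) by exact: JU.
split=> //; apply/negligibleP; first exact: J_meas.
apply: negligible_bigcup => k; apply/negligibleP; last exact: QB.
exact: J_meas.
Qed.

(** The good sets form a sigma-algebra containing both generators. The exceptional set is kept in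
    [J], hence measurable for both probabilities and admissible as a generator of [Nsa]. *)
Lemma modnullP (K : set (set Omega)) (A : set Omega) : sigma_algebra setT K ->
  join (Nsa Q F tau) K A ->
  exists C B, [/\ K C, J B, Q B = 0%E & forall w, ~ B w -> (A w <-> C w)].
Proof.
move=> sK.
have J0 : J set0 by case: (sigma_join (sigma_of tau) Finf).
pose Z := [set A : set Omega |
  exists C B, [/\ K C, J B, Q B = 0%E & forall w, ~ B w -> (A w <-> C w)]].
have sZ : sigma_algebra setT Z.
  have [K0 KC KU] := sK; split.
  - by exists set0, set0; split.
  - move=> A' [C [B [KC' JB QB AC]]]; exists (setT `\` C), B; split=> //.
      exact: KC.
    by move=> w nB; split=> -[_ h]; split=> // /(AC w nB).
  - move=> A' /choice[C] /choice[B] h.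
    have [JU QU] : J (\bigcup_k B k) /\ Q (\bigcup_k B k) = 0%E.
      by apply: J_null_bigcup => k; case: (h k).
    exists (\bigcup_k C k), (\bigcup_k B k); split=> //.
    + by apply: KU => k; case: (h k).
    + move=> w nB; split=> -[k _ hk]; exists k => //;
        (have nBk : ~ B k w by move=> Bk; apply: nB; exists k);
        by case: (h k) => _ _ _ /(_ w nBk) []; auto.
rewrite -[X in _ -> X]/(Z A); apply: joinS => //.
  apply: smallest_sub => // A' [B [JB QB AB]].
  exists set0, B; split=> //; first by case: sK.
  by move=> w nB; split=> // /AB.
move=> A' KA; exists A', set0; split=> //.
Qed.

Lemma measG_modnull (A : set TG) : measurable A ->
  exists C B, [/\ J C, J B, Q B = 0%E & forall w, ~ B w -> (A w <-> C w)].
Proof.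
move=> mA; apply: modnullP; first exact: sigma_join.
apply: smallest_sub mA; first exact: sigma_join.
move=> A' [t /=]; rewrite in_itv/= andbT => t0.
apply: joinS; first exact: sigma_join.
  by move=> B NB; apply: sub_sigma_algebra; left.
by move=> B CB; apply: sub_sigma_algebra; right; exact: Cfilt_J CB.
Qed.

Lemma G_modnull t A : G t A ->
  exists C B, [/\ Cfilt t C, J B, Q B = 0%E & forall w, ~ B w -> (A w <-> C w)].
Proof. by apply: modnullP; exact: sigma_Cfilt. Qed.

Lemma limsup_rc (K : R -> set (set Omega)) t (C : nat -> set Omega) :
  (forall s, t < s -> sigma_algebra setT (K s)) ->
  (forall n s, t + n.+1%:R^-1 < s -> K s (C n)) ->
  forall s, t < s -> K s [set w | forall n, exists k, C (n + k)%N w].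
Proof.
move=> sK KC s ts.
have [n0 hn0] : exists n0 : nat, forall k, t + (n0 + k).+1%:R^-1 < s.
  have st0 : 0 < s - t by rewrite subr_gt0.
  exists (Num.truncn (s - t)^-1) => k.
  rewrite -ltrBrDl invf_plt ?posrE//.
  apply: lt_le_trans (truncnS_gt _) _.
  by rewrite ler_nat ltnS leq_addr.
apply/sdefT.
apply: (@sdef_ext _ _ _ (fun w => forall n, exists k, C (n0 + (n + k))%N w)) => [w _|].
  split=> h' n; last by have [k] := h' (n0 + n)%N; rewrite -addnA; exists k.
  by have [k] := h' n; exists (n0 + k)%N; rewrite addnCA.
have sKs := sK s ts.
by apply: sdef_all => // n; apply: sdef_ex => // k; apply/sdefT; apply: KC; exact: hn0.
Qed.

(** Not immediate, since the null sets are added after the intersection over later times. The limsup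
    of versions at times decreasing to [t] lies in [Cfilt t], and it differs from [A] only inside
    one null set of [J], all of whose subsets are in [Nsa]. *)
Lemma G_rc t A : 0 <= t -> (forall s, t < s -> G s A) -> G t A.
Proof.
move=> t0 GA.
have /choice[C /choice[B h]] : forall n, exists C B,
    [/\ Cfilt (t + n.+1%:R^-1) C, J B, Q B = 0%E & forall w, ~ B w -> (A w <-> C w)].
  by move=> n; apply: G_modnull; apply: GA; rewrite ltrDl invr_gt0.
have GC : G t [set w | forall n, exists k, C (n + k)%N w].
  apply: Cfilt_G; apply/CfiltE.
  apply: (@limsup_rc (fun s => join (F s) (sigma_of (fun w => Order.min (tau w) s%:E)))).
    by move=> s _; exact: sigma_join.
  by move=> n s; have [/CfiltE + _ _ _] := h n; apply.
have [JB QB] : J (\bigcup_n B n) /\ Q (\bigcup_n B n) = 0%E.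
  by apply: J_null_bigcup => k; case: (h k).
have GN D : D `<=` \bigcup_n B n -> G t D.
  move=> DB; apply: sub_sigma_algebra; left; apply: sub_sigma_algebra.
  by exists (\bigcup_n B n).
have sG := sigma_G t.
apply/(sdefT (G t) A).
apply: (@sdef_ext _ _ _ (fun w => ((\bigcup_n B n) `&` A) w \/
   (~ (\bigcup_n B n) w /\ forall n, exists k, C (n + k)%N w))) => [w _|].
  have lim : ~ (\bigcup_n B n) w -> (forall n, exists k, C (n + k)%N w) <-> A w.
    move=> nB; have AC n : A w <-> C n w.
      by have [_ _ _ + ] := h n; apply=> Bn; apply: nB; exists n.
    by split=> [/(_ 0%N)[k /AC]//|/AC Cn n]; exists 0%N; apply: Cn.
  split=> [[[]//|[nB] /(lim nB)//]|Aw].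
  have [Bw|nB] := pselect ((\bigcup_n B n) w); first by left.
  by right; split=> //; apply/lim.
apply: sdef_or => //; first by apply/sdefT; apply: GN => w [].
apply: sdef_and => //; last exact/sdefT.
by apply: sdef_not => //; apply/sdefT; exact: GN.
Qed.


(** * Hypothesis (H) *)

Variable Q' : probability TG R.
Hypothesis hequiv : forall A : set Omega, <<s Ginf_gen Q F tau >> A ->
  (Q' A = 0%E <-> Q.-negligible A).
Hypothesis hH : forall M : R -> Omega -> R,
  martingale Q' F M -> martingale Q' G M.

Lemma J_null (B : set Omega) : J B -> Q B = 0%E -> Q' B = 0%E.
Proof.
move=> JB QB; apply/hequiv; first exact: J_measG.
by apply/negligibleP => //; exact: J_meas.
Qed.

Lemma J_negligible (B : set Omega) : J B -> Q B = 0%E -> Q'.-negligible (B : set TG).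
Proof.
move=> JB QB; apply/negligibleP; first exact: J_measG.
exact: J_null.
Qed.

(** Brings an exceptional set for [Q'] back to the form demanded by the conclusion: it is covered by
    a [Q]-null set of [J], a generator of [Nsa]. *)
Lemma negligible_Nsa (A : set TG) : Q'.-negligible A ->
  exists E : set Omega, [/\ Nsa Q F tau E, Q.-negligible E & A `<=` E].
Proof.
move=> [A' [mA' QA' AA']].
have [C [B [JC JB QB AC]]] := measG_modnull mA'.
have nA' : Q.-negligible (A' : set Omega) by apply/hequiv.
have QC : Q C = 0%E.
  apply/negligibleP; first exact: J_meas.
  apply: (@negligibleS _ _ _ _ ((A' : set Omega) `|` B)).
    move=> w Cw; have [Bw|nB] := pselect (B w); [by right|left].
    by apply/AC.
  by apply: negligibleU => //; apply/negligibleP => //; exact: J_meas.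
have JCB : J (C `|` B).
  apply/(sdefT J (C `|` B)); apply: sdef_or; first exact: sigma_join.
  - exact/sdefT.
  - exact/sdefT.
have QCB : Q (C `|` B) = 0%E.
  apply/negligibleP; first exact: J_meas.
  by apply: negligibleU; apply/negligibleP => //; exact: J_meas.
exists (C `|` B); split.
- by apply: sub_sigma_algebra; exists (C `|` B); split.
- by apply/negligibleP => //; exact: J_meas.
- move=> w /AA' A'w; have [Bw|nB] := pselect (B w); [by right|left].
  by apply/AC.
Qed.

Lemma meas_measG (K : set (set Omega)) (g : Omega -> R) : K `<=` @measurable _ TG ->
  meas_wrt K g -> measurable_fun (setT : set TG) g.
Proof. exact: (@meas_wrt_fun R _ TG). Qed.

Lemma meas_wrt_indic (K : set (set Omega)) (C : set Omega) : sigma_algebra setT K ->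
  K C -> meas_wrt K (\1_C : Omega -> R).
Proof.
move=> sK KC; apply/meas_wrtP => //; apply: measurable_indic.
exact: sub_sigma_algebra.
Qed.

Lemma integral_indicG (C D : set Omega) : @measurable _ TG C -> @measurable _ TG D ->
  (\int[Q']_(x in D) (\1_C x : R)%:E = Q' (C `&` D))%E.
Proof. by move=> mC mD; exact: (integral_indic Q' mD mC). Qed.

(** Versions are chosen separately at each time, and from [u] on the martingale is [\1_C] itself, so
    its value at [u] is known exactly when (H) is applied. *)
Lemma cond_exp_martingale (u : R) (C : set Omega) : 0 <= u -> F u C ->
  exists g : R -> Omega -> R, [/\
    martingale Q' F (fun s => if s < u then g s else \1_C),
    (forall s, 0 <= s -> meas_wrt (F s) (g s) /\ forall w, 0 <= g s w <= 1) &
    (forall s, 0 <= s -> forall k : Omega -> R, meas_wrt (F s) k -> (forall x, 0 <= k x) ->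
        (\int[Q']_(x in C) (k x)%:E = \int[Q']_x (k x * g s x)%:E)%E)].
Proof.
move=> u0 FC.
have mC : @measurable _ TG C by exact: (F_measG u0).
have /choice[g hg] : forall s, exists g : Omega -> R, 0 <= s ->
    [/\ meas_wrt (F s) g, (forall x, 0 <= g x <= 1),
      (forall D, F s D -> (\int[Q']_(x in D) (g x)%:E = Q' (C `&` D))%E) &
      (forall k : Omega -> R, meas_wrt (F s) k -> (forall x, 0 <= k x) ->
        (\int[Q']_(x in C) (k x)%:E = \int[Q']_x (k x * g x)%:E)%E)].
  move=> s; have [s0|s0] := leP 0 s; last by exists (fun=> 0).
  have [g hg] := cond_prob_ex Q' (sigma_F s0) (F_measG s0) mC.
  by exists g.
exists g; split.
- have ad : adapted F (fun s => if s < u then g s else \1_C).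
    move=> s s0; case: ifPn => [_|]; first by have [] := hg s s0.
    rewrite -leNgt => us; apply: (meas_wrt_indic (sigma_F s0)).
    exact: F_mono FC.
  have int s D : 0 <= s -> F s D ->
      (\int[Q']_(x in D) ((if s < u then g s else \1_C) x)%:E = Q' (C `&` D))%E.
    move=> s0 FD; case: ifPn => _; first by have [_ _ ->] := hg s s0.
    by apply: integral_indicG => //; exact: F_measG FD.
  split=> //.
  + move=> s s0; apply: measurable_bounded_integrable => //.
    * by rewrite [X in (X < _)%E]probability_setT ltry.
    * apply: (meas_measG (F_measG s0)); exact: ad.
    * apply: filterS (nbhs_pinfty_ge (num_real (1 : R))) => M M1 x _.
      apply: le_trans M1; case: ifPn => _.
        by have [_ /(_ x)/andP[g0 g1] _ _] := hg s s0; rewrite ger0_norm.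
      by rewrite indicE; case: (_ \in _); rewrite ?normr1 ?normr0.
  + move=> s t s0 st A FA; rewrite (int t)//; first by rewrite (int s).
      exact: le_trans st.
    exact: F_mono FA.
- by move=> s s0; have [] := hg s s0.
- by move=> s s0; have [] := hg s s0.
Qed.

(* For [C] in [F u], (H) applied to the martingale of [\1_C] moves the
   conditioning of [U] from [F_oo] down to [F t]. *)
Lemma cond_prob_H t (U : set Omega) : 0 <= t -> G t U ->
  exists a : Omega -> R, [/\ meas_wrt (F t) a, (forall w, 0 <= a w <= 1) &
    forall C, Finf C -> (\int[Q']_(x in C) (a x)%:E = Q' (U `&` C))%E].
Proof.
move=> t0 GU.
have mU : @measurable _ TG U by exact: (G_meas t0).
have [a [ma a01 aC aprod]] := cond_prob_ex Q' (sigma_F t0) (F_measG t0) mU.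
have maT := meas_measG (F_measG t0) ma.
have a0 w : 0 <= a w by case/andP: (a01 w).
exists a; split=> // C0 FC0.
(* For [u > t], (H) makes the measure of [C] in [U] equal to the integral of [g t] over [U]; [aprod]
   turns this into the integral of [g t * a], and [gprod] turns that into the integral of [a] over
   [C]. *)
have gen u C : 0 <= u -> F u C -> (\int[Q']_(x in C) (a x)%:E = Q' (U `&` C))%E.
  move=> u0 FC; have [ut|tu] := leP u t; first by apply: aC; exact: F_mono FC.
  have [g [Mg /(_ t t0)[mg g01] /(_ t t0) gprod]] := cond_exp_martingale u0 FC.
  have [_ _ /(_ t u t0 (ltW tu) U GU)] := hH Mg.
  rewrite ltxx tu integral_indicG//; last exact: F_measG FC.
  rewrite setIC => ->; rewrite aprod//; last by move=> w; case/andP: (g01 w).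
  by rewrite gprod//; apply: eq_integral => x _; rewrite mulrC.
pose TF : measurableType _ := g_sigma_algebraType (\bigcup_(t in `[0, +oo[%classic) F t).
have mF (C : set TF) : measurable C -> @measurable _ TG C by exact: Finf_measG.
(* The events already treated form a pi-system because [F] is increasing; a Dynkin argument reaches
   all of [Finf]. *)
apply: (@dynkin_induction _ TF (\bigcup_(t in `[0, +oo[%classic) F t)
  [set C | (\int[Q']_(x in C) (a x)%:E = Q' (U `&` C))%E]) => //.
- move=> A B [s /=]; rewrite in_itv/= andbT => s0 FA [s' /=]; rewrite in_itv/= andbT => s'0 FB.
  exists (Num.max s s'); first by rewrite /= in_itv/= andbT le_max s0.
  have m0 : 0 <= Num.max s s' by rewrite le_max s0.
  apply/(sdefT (F (Num.max s s')) (A `&` B)); apply: sdef_and; first exact: sigma_F.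
  + by apply/sdefT; apply: F_mono FA => //; rewrite le_max lexx.
  + by apply/sdefT; apply: F_mono FB => //; rewrite le_max lexx orbT.
- by apply: (gen 0) => //; apply/(sdefT (F 0) setT); apply: sdef_cst; exact: sigma_F.
- by move=> A [s /=]; rewrite in_itv/= andbT => s0 FA; exact: (gen s).
- move=> A mA' /= IA.
  have mA := mF _ mA'.
  have mAc : @measurable _ TG (~` A) by exact: measurableC.
  have IT : (\int[Q']_x (a x)%:E = Q' (U `&` setT))%E.
    by apply: (gen 0) => //; apply/(sdefT (F 0) setT); apply: sdef_cst; exact: sigma_F.
  have e1 : (\int[Q']_x (a x)%:E =
      \int[Q']_(x in A) (a x)%:E + \int[Q']_(x in ~` A) (a x)%:E)%E.
    rewrite -ge0_integral_setU//.
    + by rewrite setUv.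
    + by rewrite setUv; exact/measurable_EFinP.
    + by move=> x _; rewrite lee_fin.
    + by apply/disj_setPS => x [].
  have e2 : (Q' U = Q' (U `&` A) + Q' (U `&` ~` A))%E.
    rewrite -measureU//; first by rewrite -setIUr setUv setIT.
    + exact: measurableI.
    + exact: measurableI.
    + by apply/seteqP; split=> x //= [[_ ?] [_]].
  move: IT; rewrite setIT e1 e2 IA => /eqP.
  have fin : Q' (U `&` A) \is a fin_num.
    by rewrite fin_num_measure//; exact: measurableI.
  by rewrite eq_le !(leeD2lE _ _ fin) -eq_le => /eqP.
- move=> A mA tA /= IA.
  rewrite ge0_integral_bigcup//.
  + rewrite setI_bigcupr measure_bigcup//.
    * rewrite (eq_eseriesr (fun i _ => IA i)).
      by apply: eq_eseriesl => i; rewrite in_setT.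
    * by move=> i _; apply: measurableI => //; exact: mF.
    * exact: trivIset_setIl.
  + by move=> k; exact: mF.
  + by apply/measurable_EFinP; exact: measurable_funTS.
  + by move=> x _; rewrite lee_fin.
Qed.

Lemma cond_prob_mono (U V : set Omega) (a b : Omega -> R) :
  @measurable _ TG U -> @measurable _ TG V -> U `<=` V ->
  meas_wrt Finf a -> meas_wrt Finf b -> (forall w, 0 <= a w <= 1) -> (forall w, 0 <= b w <= 1) ->
  (forall C, Finf C -> (\int[Q']_(x in C) (a x)%:E = Q' (U `&` C))%E) ->
  (forall C, Finf C -> (\int[Q']_(x in C) (b x)%:E = Q' (V `&` C))%E) ->
  Q'.-negligible ([set w | b w < a w] : set TG).
Proof.
move=> mU mV UV ma mb a01 b01 aC bC.
have FD : Finf [set w | b w < a w].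
  have : meas_wrt Finf (fun w => a w - b w).
    apply/meas_wrtP; first exact: sigma_Finf.
    by apply: measurable_funB; apply/meas_wrtP => //; exact: sigma_Finf.
  move/(_ `]0, +oo[%classic (measurable_itv _)); congr Finf.
  by apply/seteqP; split=> w /=; rewrite in_itv/= andbT subr_gt0.
apply/negligibleP; first exact: Finf_measG.
have mD := Finf_measG FD.
apply: (@integral_le_ae_le _ _ TG Q' a b) => //.
- exact: meas_measG Finf_measG ma.
- exact: meas_measG Finf_measG mb.
- by move=> w; case/andP: (a01 w).
- by move=> w; case/andP: (b01 w).
- rewrite (aC _ FD) (bC _ FD); apply: le_measure; rewrite ?inE.
  + exact: measurableI.
  + exact: measurableI.
  + exact: setSI.
- by rewrite (bC _ FD) (le_lt_trans (probability_le1 _ _))// ?ltry//; exact: measurableI.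
Qed.

(** Monotonicity and right-continuity are obtained for every [w], so that the versions are cadlag
    processes and may enter optional sets. *)
Lemma cond_prob_incr (U : R -> set Omega) :
  (forall t, 0 <= t -> G t (U t)) ->
  (forall s t, 0 <= s -> s <= t -> U s `<=` U t) ->
  (forall t w, 0 <= t -> (forall s, t < s -> U s w) -> U t w) ->
  exists A : R -> Omega -> R, [/\ adapted F A,
    (forall w s t, s <= t -> A s w <= A t w),
    (forall w t c, A t w < c -> exists q, t < q /\ forall s, s < q -> A s w < c),
    (forall t w, 0 <= A t w <= 1) &
    forall t, 0 <= t -> forall C, Finf C ->
      (\int[Q']_(x in C) (A t x)%:E = Q' (U t `&` C))%E].
Proof.
move=> GU Umono Urc.
have mU t : 0 <= t -> @measurable _ TG (U t) by move=> t0; apply: (G_meas t0); exact: GU.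
have /choice[a ha] : forall t, exists a : Omega -> R, 0 <= t ->
    [/\ meas_wrt (F t) a, (forall w, 0 <= a w <= 1) &
    forall C, Finf C -> (\int[Q']_(x in C) (a x)%:E = Q' (U t `&` C))%E].
  move=> t; have [t0|t0] := leP 0 t; last by exists (fun=> 0).
  by have [a ha] := cond_prob_H t0 (GU t t0); exists a.
have maF t : 0 <= t -> meas_wrt Finf (a t).
  by move=> t0; have [ma _ _] := ha t t0; exact: meas_wrtS (F_Finf t0) ma.
(* [A t] is the right limit of the running supremum of versions at rational
   times; this makes it monotone and right-continuous for every [w]. *)
pose Z t w := [set c : R | 0 <= c /\ exists q : rat, t < ratr q /\
  forall r : rat, 0 <= ratr r :> R -> (ratr r : R) <= ratr q -> a (ratr r) w <= c].
pose A t w := inf (Z t w).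
have Z1 t w : Z t w 1.
  split=> //; have t1 : t < t + 1 by rewrite ltrDl.
  have [q /andP[tq _]] := rat_between t1.
  exists q; split=> // r r0 _.
  by have [_ /(_ w)/andP[]] := ha _ r0.
have Zlb t w : has_lbound (Z t w) by exists 0 => c [].
have Zne t w : Z t w !=set0 by exists 1; exact: Z1.
have Ale t w c : Z t w c -> A t w <= c by exact: ge_inf.
have Age t w c : (forall c', Z t w c' -> c <= c') -> c <= A t w by exact: lb_le_inf.
have Alt t w c : A t w < c -> exists2 c', Z t w c' & c' < c by exact: inf_lt.
have A01 t w : 0 <= A t w <= 1.
  by apply/andP; split; [apply: Age => c []|exact: Ale].
have Amono w s t : s <= t -> A s w <= A t w.
  move=> st; apply: Age => c [c0 [q [tq h]]]; apply: Ale; split=> //; exists q; split=> //.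
  exact: le_lt_trans tq.
have Arc w t c : A t w < c -> exists q, t < q /\ forall s, s < q -> A s w < c.
  move=> /Alt[c' [c'0 [q [tq h]]] c'c]; exists (ratr q); split=> // s sq.
  by apply: le_lt_trans c'c; apply: Ale; split=> //; exists q.
have Aad : adapted F A.
  move=> t t0 B mB.
  (* [Z t w] looks strictly beyond [t], so [A t] is first seen to be measurable for each later
     [F s]; right-continuity of [F] brings it back to [F t]. *)
  rewrite (hFrc t0) => s /=; rewrite in_itv/= andbT => ts.
  have s0 : 0 <= s by rewrite (le_trans t0)// ltW.
  have sF := sigma_F s0.
  apply/sdefT; apply: (sdef_borel_lt sF) mB => c.
  apply: (@sdef_ext _ _ _ (fun w => exists qc : rat * rat,
      ((t < ratr qc.1 /\ ratr qc.1 < s) /\ ratr qc.2 < c /\ 0 <= ratr qc.2 :> R) /\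
      forall r : rat, (0 <= ratr r :> R /\ (ratr r : R) <= ratr qc.1) ->
        a (ratr r) w <= ratr qc.2)) => [w _|].
    split=> [[[q c']/= [[[tq qs] [c'c c'0]] h]]|/Alt[c' [c'0 [q [tq h]]] c'c]].
      apply: le_lt_trans c'c; apply: Ale; split=> //; exists q; split=> // r r0 rq.
      exact: h.
    have [c'' /andP[cc'' c''c]] := rat_between c'c.
    have tqs : t < Num.min (ratr q) s by rewrite lt_min tq.
    have [q' /andP[tq']] := rat_between tqs; rewrite lt_min => /andP[q'q q's].
    exists (q', c'') => /=; split.
      by do 2 (split; first by []); rewrite ltW// (le_lt_trans c'0).
    move=> r [r0 rq']; apply: (le_trans _ (ltW cc'')).
    by apply: h => //; rewrite (le_trans rq')// ltW.
  apply: sdef_ex => // -[q c'] /=; apply: sdef_guard => // -[[tq qs] [c'c c'0]].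
  apply: sdef_all => // r; apply: sdef_guard_imply => // -[r0 rq].
  have [mar _ _] := ha _ r0.
  apply/sdefT; apply: (F_mono r0 (le_trans rq (ltW qs))).
  have := mar `]-oo, ratr c']%classic (measurable_itv _).
  by congr F; apply/seteqP; split=> w /=; rewrite in_itv.
exists A; split=> // t t0 C FC.
have mC := Finf_measG FC.
have mAt : measurable_fun (setT : set TG) (A t).
  by apply: (meas_measG (F_measG t0)); exact: Aad.
have mat u : 0 <= u -> measurable_fun (setT : set TG) (a u).
  by move=> u0; exact: (meas_measG Finf_measG (maF u u0)).
have a0 u : 0 <= u -> forall w, 0 <= a u w.
  by move=> u0 w; have [_ /(_ w)/andP[]] := ha u u0.
have neg u v : 0 <= u -> u <= v -> Q'.-negligible ([set w | a v w < a u w] : set TG).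
  move=> u0 uv; have v0 := le_trans u0 uv.
  have [_ ? ?] := ha u u0; have [_ ? ?] := ha v v0.
  by apply: (@cond_prob_mono (U u) (U v)) => //;
    [exact: mU|exact: mU|exact: Umono|exact: maF|exact: maF].
(* Almost surely [a u w] itself belongs to [Z t w], any rational between [t] and [u] being a
   witness. *)
have up u : t < u -> (\int[Q']_(x in C) (A t x)%:E <= Q' (U u `&` C))%E.
  move=> tu; have u0 : 0 <= u by rewrite (le_trans t0)// ltW.
  have [_ _ /(_ C FC) <-] := ha u u0.
  apply: (@ae_le_integral_le _ _ TG) => //; [exact: mat| |exact: a0|].
    by move=> w; case/andP: (A01 t w).
  have [q /andP[tq qu]] := rat_between tu.
  apply: (@negligibleS _ _ _ _ [set w : TG | exists r : rat,
      (0 <= ratr r :> R /\ (ratr r : R) <= ratr q) /\ a u w < a (ratr r) w]).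
    move=> w /= uA; apply: contrapT => nE.
    move: uA; apply/negP; rewrite -leNgt; apply: Ale; split; first exact: a0.
    exists q; split=> // r r0 rq; rewrite leNgt; apply/negP => ua; apply: nE.
    by exists r.
  apply: negligible_ex => r; apply: negligible_guard => -[r0 rq].
  by apply: neg => //; rewrite (le_trans rq)// ltW.
(* Upper bound: let [u] decrease to [t] in [up]. Lower bound: almost surely [a t] lies below [a] at
   every later rational time, hence below the infimum. *)
apply/eqP; rewrite eq_le; apply/andP; split.
  pose u n := t + n.+1%:R^-1.
  rewrite (_ : U t `&` C = \bigcap_n (U (u n) `&` C)); last first.
    apply/seteqP; split=> w /=.
      move=> [Uw Cw] n _; split=> //; apply: Umono Uw => //.
      by rewrite lerDl invr_ge0.
    move=> h; split; last by case: (h 0%N I).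
    apply: Urc => // s ts.
    have st0 : 0 < s - t by rewrite subr_gt0.
    have [Uw _] := h (Num.truncn (s - t)^-1) I.
    apply: Umono Uw; first by rewrite addr_ge0// invr_ge0.
    by rewrite /u -lerBrDl invf_ple ?posrE//; exact/ltW/truncnS_gt.
  have un0 n : 0 <= u n by rewrite addr_ge0// invr_ge0.
  apply: measure_bigcap_ge => n.
  - by apply: measurableI => //; exact: mU.
  - apply: setSI; apply: Umono => //.
    by rewrite lerD2l lef_pV2 ?posrE// ler_nat.
  - by apply: up; rewrite ltrDl invr_gt0.
have [_ _ /(_ C FC) <-] := ha t t0.
apply: (@ae_le_integral_le _ _ TG) => //; [exact: mat|exact: a0| |].
  by move=> w; case/andP: (A01 t w).
apply: (@negligibleS _ _ _ _ [set w : TG | exists r : rat,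
    t < ratr r /\ a (ratr r) w < a t w]).
  move=> w /= /Alt[c [c0 [q [tq h]]] ca].
  exists q; split=> //; apply: le_lt_trans ca; apply: h => //.
  by rewrite (le_trans t0)// ltW.
by apply: negligible_ex => r; apply: negligible_guard => /ltW; exact: neg.
Qed.

(** * Approximation by the finite partitions *)

Local Notation smallG := (small Q').

(** Up to [e], the event is determined by [Finf] and the cell of [tau]. Asking this for all large
    [n] lets several events share a partition. *)
Definition approximable (B : set Omega) := forall e, 0 < e -> exists m : nat,
  forall n, (m <= n)%N -> exists b : n.-tuple bool -> set Omega,
    (forall i, Finf (b i)) /\
    smallG e [set w : TG | ~ (B w <-> b (cell n (tau w)) w)].

Lemma small_null (e : R) (D B : set Omega) : 0 <= e -> J B -> Q B = 0%E -> D `<=` B ->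
  smallG e (D : set TG).
Proof.
move=> e0 JB QB DB; exists B; split=> //; first exact: J_measG.
by rewrite (J_null JB QB) lee_fin.
Qed.

Lemma approximable0 : approximable set0.
Proof.
move=> e e0; exists 0%N => n _; exists (fun=> set0); split.
  by move=> _; case: sigma_Finf.
exists set0; split=> //; last by rewrite measure0 lee_fin ltW.
by move=> w [].
Qed.

Lemma approximableC B : approximable B -> approximable (~` B).
Proof.
move=> aB e e0; have [m hm] := aB e e0; exists m => n mn.
have [b [Fb sb]] := hm n mn; exists (fun i => ~` b i); split.
  move=> i; apply/(sdefT Finf (~` b i)); apply: sdef_not; first exact: sigma_Finf.
  by apply/sdefT; exact: Fb.
apply: smallS sb => w /= h1 h2; apply: h1; split=> h3 h4; apply: h3; exact/h2.
Qed.

Lemma approximableU B B' : approximable B -> approximable B' -> approximable (B `|` B').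
Proof.
move=> aB aB' e e0; have e20 : 0 < e / 2 by rewrite divr_gt0.
have [m hm] := aB _ e20; have [m' hm'] := aB' _ e20.
exists (maxn m m') => n; rewrite geq_max => /andP[mn m'n].
have [b [Fb sb]] := hm n mn; have [b' [Fb' sb']] := hm' n m'n.
exists (fun i => b i `|` b' i); split.
  move=> i; apply/(sdefT Finf (b i `|` b' i)); apply: sdef_or; first exact: sigma_Finf.
  - by apply/sdefT; exact: Fb.
  - by apply/sdefT; exact: Fb'.
rewrite [e]splitr; apply: smallS (smallU sb sb') => w /= h.
apply: contrapT => h'; apply: h.
have h1 : B w <-> b (cell n (tau w)) w by apply: contrapT => h''; apply: h'; left.
have h2 : B' w <-> b' (cell n (tau w)) w by apply: contrapT => h''; apply: h'; right.
by split=> -[|] ?; [left; apply/h1|right; apply/h2|left; apply/h1|right; apply/h2].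
Qed.

(** A finite union already captures all but [e / 2] of the measure; the other half of the error goes
    to approximating that finite union. *)
Lemma approximable_bigcup (B : nat -> set Omega) :
  (forall k, @measurable _ TG (B k)) -> (forall k, approximable (B k)) ->
  approximable (\bigcup_k B k).
Proof.
move=> mB aB e e0; have e20 : 0 < e / 2 by rewrite divr_gt0.
pose BK K := \big[setU/set0]_(k < K) B k.
have mBK K : @measurable _ TG (BK K) by apply: bigsetU_measurable => k _.
have aBK K : approximable (BK K).
  rewrite /BK; elim: K => [|K IH]; first by rewrite big_ord0; exact: approximable0.
  by rewrite big_ord_recr/=; exact: approximableU.
have mU : @measurable _ TG (\bigcup_k B k) by exact: bigcupT_measurable.
have [K hK] : exists K, (Q' ((\bigcup_k B k) `\` BK K) <= (e / 2)%:E)%E.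
  apply: contrapT => nK.
  have : ((e / 2)%:E <= Q' (\bigcap_K ((\bigcup_k B k) `\` BK K)))%E.
    apply: measure_bigcap_ge => K.
    - exact: measurableD.
    - apply: setDS; rewrite /BK big_ord_recr/=; exact: subsetUl.
    - by rewrite leNgt; apply/negP => /ltW h; apply: nK; exists K.
  rewrite (_ : \bigcap_K _ = set0) ?measure0 ?lee_fin ?leNgt ?e20//.
  apply/seteqP; split=> w // h; have [[k _ Bk] _] := h 0%N I.
  have [_] := h k.+1 I; apply; rewrite /BK -bigcup_mkord; exists k => //=.
have [m hm] := aBK K _ e20; exists m => n mn; have [b [Fb sb]] := hm n mn.
exists b; split=> //; rewrite [e]splitr.
have st : smallG (e / 2) ((\bigcup_k B k) `\` BK K).
  by exists ((\bigcup_k B k) `\` BK K); split=> //; exact: measurableD.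
apply: smallS (smallU sb st) => w /= h.
apply: contrapT => h'; apply: h.
have h1 : BK K w <-> b (cell n (tau w)) w by apply: contrapT => h''; apply: h'; left.
split=> [UB|/h1].
  by apply/h1; apply: contrapT => nBK; apply: h'; right.
by rewrite /BK -bigcup_mkord => -[k _ Bk]; exists k.
Qed.

(** Events of [Finf] and rays of [tau] are matched without error, and subsets of null sets by
    [set0]; the good sets do the rest. *)
Lemma measG_approximable (B : set Omega) : @measurable _ TG B -> approximable B.
Proof.
pose Z := [set B : set Omega | @measurable _ TG B /\ approximable B].
have sZ : sigma_algebra setT Z.
  split.
  - by split; [exact: measurable0|exact: approximable0].
  - move=> A [mA aA]; rewrite setTD; split; last exact: approximableC.
    exact: (@measurableC _ TG).
  - move=> A hA; split; last by apply: approximable_bigcup => k; case: (hA k).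
    by apply: (@bigcupT_measurable _ TG) => k; case: (hA k).
suff h : @measurable _ TG `<=` Z by move=> /h[].
have FZ : Finf `<=` Z.
  move=> A FA; split; first exact: Finf_measG.
  move=> e e0; exists 0%N => n _; exists (fun=> A); split=> //.
  exists set0; split=> //; last by rewrite measure0 lee_fin ltW.
  by move=> w [].
have tZ : sigma_of tau `<=` Z.
  move=> _ [A mA <-].
  apply: (@ereal_rays_ind R [set A | Z (tau @^-1` A)]) mA.
    have [Z0 ZC ZU] := sZ; split=> //.
    - by move=> A' ZA; have := ZC _ ZA; rewrite !setTD.
    - by move=> A' ZA /=; rewrite preimage_bigcup; exact: ZU.
  move=> k; split.
    apply: tau_measG; rewrite (_ : [set x | _] = `]-oo, (qn k)%:E[%classic).
      exact: emeasurable_itv.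
    by apply/seteqP; split=> x /=; rewrite in_itv.
  (* Once [n > k], coordinate [k] of the cell decides whether [tau < qn k], so each [b i] is empty
     or the whole space. *)
  move=> e e0; exists k.+1 => n kn.
  exists (fun i : n.-tuple bool => [set w : Omega | is_true (tnth i (Ordinal kn))]); split.
    move=> i; apply/sdefT; apply: sdef_cst; exact: sigma_Finf.
  exists set0; split=> //; last by rewrite measure0 lee_fin ltW.
  by move=> w /=; rewrite tnth_mktuple => -[].
have JZ : J `<=` Z by exact: joinS.
apply: smallest_sub => // A [t /=]; rewrite in_itv/= andbT => t0.
apply: joinS => //; last by move=> B' CB; apply: JZ; exact: Cfilt_J CB.
apply: smallest_sub => // B' [C [JC QC BC]]; split.
  apply: (@G_meas 0) => //; apply: sub_sigma_algebra; left.
  by apply: sub_sigma_algebra; exists C.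
move=> e e0; exists 0%N => n _; exists (fun=> set0); split.
  by move=> _; case: sigma_Finf.
apply: (small_null (ltW e0) JC QC) => w /= h.
by apply: contrapT => nC; apply: h; split=> // /BC.
Qed.

(** * Optional sets *)

Lemma sigma_optional (H : R -> set (set Omega)) : sigma_algebra timedom (optional H).
Proof. exact: smallest_sigma_algebra. Qed.

Lemma sigma_borel_optional (H : R -> set (set Omega)) :
  sigma_algebra ext_timedom (borel_optional H).
Proof. exact: smallest_sigma_algebra. Qed.

Local Notation defO := (sdef timedom (optional F)).
Local Notation defBO := (sdef ext_timedom (borel_optional F)).

Lemma defO_cadlag (X : R -> Omega -> R) (B : set R) : cadlag X -> adapted F X ->
  measurable B -> defO (fun p => B (X p.1 p.2)).
Proof.
move=> cX aX mB; constructor; apply: sub_sigma_algebra; exists X, B; split=> //.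
Qed.

(** The indicator of such a family is itself an adapted cadlag process. *)
Lemma defO_incr (U : R -> set Omega) :
  (forall t, 0 <= t -> F t (U t)) -> (forall s t, s <= t -> U s `<=` U t) ->
  (forall t w, (forall s, t < s -> U s w) -> U t w) ->
  defO (fun p => U p.1 p.2).
Proof.
move=> FU Umono Urc.
pose X t w : R := \1_(U t) w.
have cX : cadlag X.
  apply: mono_cadlag => [w s t st|w t c].
    rewrite /X !indicE; have [Us|nUs] := pselect (U s w).
      by rewrite !mem_set//; exact: Umono Us.
    by rewrite (memNset nUs).
  rewrite /X indicE; have [Ut|nUt] := pselect (U t w).
    rewrite mem_set// => c1; exists (t + 1); rewrite ltrDl; split=> // s _.
    by rewrite indicE; case: (_ \in _) => //; exact: lt_trans c1.
  rewrite memNset// => c0.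
  have [s [ts nUs]] : exists s, t < s /\ ~ U s w.
    apply: contrapT => h; apply: nUt; apply: Urc => s ts.
    by apply: contrapT => nUs; apply: h; exists s.
  exists s; split=> // u us; rewrite indicE memNset// => Uu; apply: nUs.
  by apply: Umono Uu; exact: ltW.
have aX : adapted F X.
  by move=> t t0; apply: (meas_wrt_indic (sigma_F t0)); exact: FU.
apply: (sdef_ext _ (defO_cadlag cX aX (measurable_itv `]0, +oo[))) => -[t w] t0 /=.
rewrite in_itv/= andbT /X indicE.
have [Ut|nUt] := pselect (U t w); first by rewrite mem_set// ltr01.
by rewrite memNset// ltxx.
Qed.

(** The strict inequality is not right-continuous in time; it is a countable union of the conditions
    [ratr r <= p.1], which are. *)
Lemma defO_gt s (A : set Omega) : 0 <= s -> F s A -> defO (fun p => s < p.1 /\ A p.2).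
Proof.
move=> s0 FA.
apply: (@sdef_ext _ _ _ (fun p : R * Omega => exists r : rat, s < ratr r /\
    ((ratr r : R) <= p.1 /\ A p.2))) => [[t w] _ /=|].
  split=> [[r [sr [rt Aw]]]|[/rat_between[r /andP[sr rt]] Aw]].
    by split=> //; exact: lt_le_trans rt.
  by exists r; rewrite sr ltW.
apply: sdef_ex; first exact: sigma_optional.
move=> r; apply: sdef_guard; first exact: sigma_optional.
move=> sr; apply: (@defO_incr (fun t => [set w | (ratr r : R) <= t /\ A w])).
- move=> t t0; apply/sdefT; apply: sdef_guard; first exact: sigma_F.
  by move=> rt; apply/sdefT; apply: F_mono FA => //; rewrite (le_trans _ rt)// ltW.
- by move=> u t ut w [ru Aw]; split=> //; exact: le_trans ut.
- move=> t w h; have [_ Aw] := h (t + 1) (ltr_pwDr ltr01 (lexx _)).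
  split=> //; apply/ler_addgt0Pr => e e0.
  by have [] := h (t + e) (ltr_pwDr e0 (lexx _)).
Qed.

Lemma defBO_rect (A : set (\bar R)) (C : R * Omega -> Prop) : measurable A ->
  defO C -> defBO (fun q => A q.1 /\ C q.2).
Proof.
move=> mA [OC]; constructor; apply: sub_sigma_algebra.
exists (A `&` [set x | (0 <= x)%E]), [set p | timedom p /\ C p]; split=> //.
- apply: measurableI => //; rewrite (_ : [set x | _] = `[0%E, +oo[%classic `|` [set +oo%E]).
    by apply: measurableU; [exact: emeasurable_itv|exact: emeasurable_set1].
  apply/seteqP; split=> x /=; rewrite in_itv/= andbT; last by move=> [//|->]; rewrite leey.
  by left.
- apply/seteqP; split=> -[u [t w]] /=.
    by move=> [[u0 t0] [Au Cp]].
  by move=> [[Au u0] [t0 Cp]].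
Qed.

(** Strictly after [s], an event of [F s] gives an optional set while [tau] can be frozen as a
    parameter; good sets extend this to the join. *)
Lemma defBO_after s (C : set Omega) : 0 <= s ->
  join (F s) (sigma_of (fun w => Order.min (tau w) s%:E)) C ->
  exists D : \bar R -> Omega -> Prop, 
    defBO (fun q => s < q.2.1 /\ D q.1 q.2.2) /\ forall w, C w <-> D (tau w) w.
Proof.
move=> s0.
have sB := sigma_borel_optional F.
pose Z := [set C : set Omega | exists D : \bar R -> Omega -> Prop,
    defBO (fun q => s < q.2.1 /\ D q.1 q.2.2) /\ forall w, C w <-> D (tau w) w].
have FT : F s setT by apply/(sdefT (F s) setT); apply: sdef_cst; exact: sigma_F.
have dT : defBO (fun q => s < q.2.1).
  apply: (sdef_ext _ (defBO_rect measurableT (defO_gt s0 FT))) => q _.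
  by split=> [[_ []]|].
rewrite -[X in _ -> X]/(Z C); apply: joinS; first split.
- exists (fun _ _ => False); split=> //.
  by apply: (@sdef_ext _ _ _ (fun=> False)) => [q _|]; [split=> // -[]|exact: sdef_cst].
- move=> A [D [dD hD]]; exists (fun u w => ~ D u w); split; last first.
    by move=> w; split=> [[_ nA] /hD|nD]//; split=> // /hD.
  apply: (sdef_ext _ (sdef_and sB dT (sdef_not sB dD))) => q _.
  by split=> -[sq h]; split=> //; [move=> D'; apply: h|move=> -[_ D']; apply: h].
- move=> A /choice[D hD]; exists (fun u w => exists k, D k u w); split.
    apply: (sdef_ext _ (sdef_exn sB (fun k => (hD k).1))) => q _.
    by split=> [[k [sq Dk]]|[sq [k Dk]]]; [split=> //; exists k|exists k].
  move=> w; split=> [[k _ Ak]|[k Dk]]; exists k => //; exact/(hD k).2.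
- move=> A FA; exists (fun _ w => A w); split=> //.
  apply: (sdef_ext _ (defBO_rect measurableT (defO_gt s0 FA))) => q _.
  by split=> [[]|].
- move=> _ [B mB <-]; exists (fun u _ => B (Order.min u s%:E)); split=> //.
  have mB' : measurable [set u : \bar R | B (Order.min u s%:E)].
    have : measurable_fun setT (fun x : \bar R => Order.min x s%:E).
      by apply: measurable_mine => //; exact: measurable_cst.
    by move=> /(_ measurableT B mB); rewrite setTI.
  apply: (sdef_ext _ (defBO_rect mB' (defO_gt s0 FT))) => q _.
  by split=> [[? []]|[]].
Qed.

(** Where [s <= tau] the stopped variable is the constant [s] and adds nothing to [F s]. *)
Lemma trace_before s (C : set Omega) : 0 <= s ->
  join (F s) (sigma_of (fun w => Order.min (tau w) s%:E)) C ->
  exists A, F s A /\ forall w, (s%:E <= tau w)%E -> (C w <-> A w).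
Proof.
move=> s0; have [F0 FC FU] := sigma_F s0.
pose Z := [set C : set Omega | exists A, F s A /\ forall w, (s%:E <= tau w)%E -> (C w <-> A w)].
rewrite -[X in _ -> X]/(Z C); apply: joinS; first split.
- by exists set0.
- move=> B [A [FA h]]; exists (setT `\` A); split; first exact: FC.
  by move=> w sw; split=> -[_ n]; split=> // /(h w sw).
- move=> B /choice[A h]; exists (\bigcup_k A k); split; first by apply: FU => k; case: (h k).
  by move=> w sw; split=> -[k _ hk]; exists k => //; exact/((h k).2 w sw).
- by move=> A FA; exists A.
- move=> _ [B mB <-]; exists [set w | B s%:E]; split.
    by apply/sdefT; apply: sdef_cst; exact: sigma_F.
  by move=> w sw /=; rewrite min_r.
Qed.

(** Traces are taken at [u n] decreasing to [t]. A point with [t < tau] satisfies [u n <= tau] for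
    all large [n], so the limsup of the traces agrees there with the event, and right-continuity
    puts it in [F t]. *)
Lemma G_before_tau t (A : set Omega) : 0 <= t -> G t A ->
  exists A', F t A' /\ Q'.-negligible [set w : TG | (t%:E < tau w)%E /\ ~ (A w <-> A' w)].
Proof.
move=> t0 GA; have [C [B [CC JB QB AC]]] := G_modnull GA.
pose u n := t + n.+1%:R^-1.
have u0 n : 0 <= u n by rewrite addr_ge0// invr_ge0.
have /choice[A' hA'] : forall n, exists A, F (u n) A /\
    forall w, ((u n)%:E <= tau w)%E -> (C w <-> A w).
  move=> n; apply: trace_before => //; move/CfiltE : CC; apply.
  by rewrite ltrDl invr_gt0.
exists [set w | forall n, exists k, A' (n + k)%N w]; split.
  rewrite (hFrc t0) => s /=; rewrite in_itv/= andbT; apply: (@limsup_rc F).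
    by move=> s' ts'; apply: sigma_F; rewrite (le_trans t0)// ltW.
  by move=> n s' us'; apply: (F_mono (u0 n) (ltW us')); case: (hA' n).
apply: negligibleS (J_negligible JB QB) => w [tw h]; apply: contrapT => nB; apply: h.
rewrite (AC w nB).
have [n0 hn0] : exists n0, forall n, (n0 <= n)%N -> ((u n)%:E <= tau w)%E.
  have [r [tr rw]] : exists r, t < r /\ (r%:E <= tau w)%E.
    case: (tau w) tw => [r| |//] => [tr|_]; first by exists r.
    by exists (t + 1); rewrite ltrDl leey.
  have rt0 : 0 < r - t by rewrite subr_gt0.
  exists (Num.truncn (r - t)^-1) => n hn; apply: le_trans rw.
  rewrite lee_fin /u -lerBrDl invf_ple ?posrE//.
  by apply: le_trans (ltW (truncnS_gt _)) _; rewrite ler_nat ltnS.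
split=> [Cw n|h].
  by exists n0; apply/(hA' _).2 => //; apply: hn0; rewrite leq_addl.
by have [k /(hA' _).2] := h n0; apply; apply: hn0; rewrite leq_addr.
Qed.

(** One exceptional set serves all times at once, as indistinguishability demands; it is converted
    from [Q'] to [Nsa] only at the end. *)
Definition splittable (S : set (R * Omega)) :=
  exists (S' : set (R * Omega)) (S'' : set (\bar R * (R * Omega))),
  [/\ optional F S', borel_optional F S'' &
    Q'.-negligible [set w : TG | exists t, 0 <= t /\
      ~ (S (t, w) <-> if (t%:E < tau w)%E then S' (t, w) else S'' (tau w, (t, w)))]].

Lemma sigma_splittable : sigma_algebra timedom splittable.
Proof.
have [z0 zC zU] := sigma_optional F; have [B0 BC BU] := sigma_borel_optional F.
split.
- exists set0, set0; split=> //.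
  apply: (@negligibleS _ _ _ _ set0); last exact: negligible_set0.
  by move=> w [t [_ h]]; apply: h; case: ifP.
- move=> S [S' [S'' [OS BS neg]]]; exists (timedom `\` S'), (ext_timedom `\` S''); split.
  + exact: zC.
  + exact: BC.
  + apply: negligibleS neg => w [t [t0 h]]; exists t; split=> // h'; apply: h.
    have ed : ext_timedom (tau w, (t, w)) by split=> //=; exact: htau_pos.
    by case: ifP h' => _ h'; split=> -[_ n]; split=> // /h'.
- move=> S /choice[S' /choice[S'' h]]; exists (\bigcup_k S' k), (\bigcup_k S'' k); split.
  + by apply: zU => k; case: (h k).
  + by apply: BU => k; case: (h k).
  + apply: (@negligibleS _ _ _ _ [set w : TG | exists k t, 0 <= t /\
      ~ (S k (t, w) <-> if (t%:E < tau w)%E then S' k (t, w) else S'' k (tau w, (t, w)))]).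
      move=> w [t [t0 hn]]; apply: contrapT => nk; apply: hn.
      have hk k : S k (t, w) <->
          if (t%:E < tau w)%E then S' k (t, w) else S'' k (tau w, (t, w)).
        by apply: contrapT => hk; apply: nk; exists k, t.
      by case: ifP hk => _ hk; split=> -[k _ Sk]; exists k => //; exact/hk.
    by apply: negligible_ex => k; case: (h k).
Qed.

(** * Splitting a stopping time *)

Lemma meas_wrt_lt (K : set (set Omega)) (f g : Omega -> R) : sigma_algebra setT K ->
  meas_wrt K f -> meas_wrt K g -> K [set w | f w < g w].
Proof.
move=> sK mf mg.
have : meas_wrt K (fun w => g w - f w).
  apply/meas_wrtP => //; by apply: measurable_funB; apply/meas_wrtP.
move/(_ `]0, +oo[%classic (measurable_itv _)); congr K.
by apply/seteqP; split=> w /=; rewrite in_itv/= andbT subr_gt0.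
Qed.

Lemma meas_wrtZ (K : set (set Omega)) (l : R) (f : Omega -> R) : sigma_algebra setT K ->
  meas_wrt K f -> meas_wrt K (fun w => l * f w).
Proof.
move=> sK mf; apply/meas_wrtP => //; apply: measurable_funM; first exact: measurable_cst.
exact/meas_wrtP.
Qed.

Lemma integral_leZ (C : set TG) (f g : Omega -> R) (l : R) : measurable C -> 0 <= l ->
  measurable_fun (setT : set TG) f -> measurable_fun (setT : set TG) g ->
  (forall w, 0 <= f w) -> (forall w, 0 <= g w) -> (forall w, C w -> f w <= l * g w) ->
  (\int[Q']_(x in C) (f x)%:E <= l%:E * \int[Q']_(x in C) (g x)%:E)%E.
Proof.
move=> mC l0 mf mg f0 g0 fg.
have mgC : measurable_fun C (EFin \o g) by apply/measurable_EFinP; exact: measurable_funTS.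
rewrite -ge0_integralZl//.
- apply: ge0_le_integral => //.
  + by move=> x _; rewrite lee_fin.
  + by apply/measurable_EFinP; exact: measurable_funTS.
  + exact: measurable_funeM.
- by move=> x _; rewrite lee_fin.
Qed.

(** [X t] is a version of the conditional probability of [U t] given [Finf], in the regular form
    supplied by [cond_prob_incr]. *)
Definition cond_version (X : R -> Omega -> R) (U : R -> set Omega) :=
  [/\ adapted F X,
    (forall w s t, s <= t -> X s w <= X t w),
    (forall w t c, X t w < c -> exists q, t < q /\ forall s, s < q -> X s w < c),
    (forall t w, 0 <= X t w <= 1) &
    forall t, 0 <= t -> forall C, Finf C ->
      (\int[Q']_(x in C) (X t x)%:E = Q' (U t `&` C))%E].

Lemma version_Finf X U t : cond_version X U -> 0 <= t -> meas_wrt Finf (X t).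
Proof. by move=> [aX _ _ _ _] t0; apply: meas_wrtS (F_Finf t0) (aX t t0). Qed.

Lemma version_measG X U t : cond_version X U -> 0 <= t ->
  measurable_fun (setT : set TG) (X t).
Proof. by move=> vX t0; apply: meas_measG Finf_measG _; exact: version_Finf vX t0. Qed.

Section stopping_family.
Variable L : R -> set Omega.
Hypotheses (GL : forall t, 0 <= t -> G t (L t))
  (Lmono : forall s t, 0 <= s -> s <= t -> L s `<=` L t)
  (Lrc : forall t w, 0 <= t -> (forall s, t < s -> L s w) -> L t w).

Definition Hset n (i : n.-tuple bool) t : set Omega :=
  [set w | cell n (tau w) = i /\ (tau w <= t%:E)%E].

Definition Aset n (i : n.-tuple bool) t : set Omega := Hset i t `&` L t.

Lemma L_measG t : 0 <= t -> @measurable _ TG (L t).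
Proof. by move=> t0; apply: (G_meas t0); exact: GL. Qed.

Lemma Hset_G n (i : n.-tuple bool) t : G t (Hset i t).
Proof. apply: Cfilt_G; exact (@tau_le_Cfilt t _ (cell_measurable i)). Qed.

Lemma Hset_mono n (i : n.-tuple bool) s t : s <= t -> Hset i s `<=` Hset i t.
Proof.
by move=> st w [wi ws]; split=> //; rewrite (le_trans ws)// lee_fin.
Qed.

Lemma le_rc (x : \bar R) t : (forall s, t < s -> (x <= s%:E)%E) -> (x <= t%:E)%E.
Proof.
move=> h; apply/lee_addgt0Pr => e e0; rewrite -EFinD; apply: h.
by rewrite ltrDl.
Qed.

Lemma Hset_version n (i : n.-tuple bool) : exists X, cond_version X (Hset i).
Proof.
apply: cond_prob_incr => [t t0|s t _|t w t0 h]; [exact: Hset_G|exact: Hset_mono|].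
have [wi _] := h (t + 1) (ltr_pwDr ltr01 (lexx _)).
by split=> //; apply: le_rc => s /h[].
Qed.

Lemma Aset_version n (i : n.-tuple bool) : exists X, cond_version X (Aset i).
Proof.
apply: cond_prob_incr => [t t0|s t s0 st|t w t0 h].
- apply/(sdefT (G t) (Aset i t)); apply: sdef_and; first exact: sigma_G.
  + by apply/sdefT; exact: Hset_G.
  + by apply/sdefT; exact: GL.
- by apply: setISS; [exact: Hset_mono|exact: Lmono].
- split; last by apply: Lrc => // s /h[].
  have [[wi _] _] := h (t + 1) (ltr_pwDr ltr01 (lexx _)).
  by split=> //; apply: le_rc => s /h[[]].
Qed.

Lemma tau_le_measG t : @measurable _ TG [set w | (tau w <= t%:E)%E].
Proof.
apply: (@tau_measG [set x | (x <= t%:E)%E]).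
rewrite (_ : [set x | _] = `]-oo, t%:E]%classic); first exact: emeasurable_itv.
by apply/seteqP; split=> x /=; rewrite in_itv.
Qed.

Lemma cell_measG n (i : n.-tuple bool) :
  @measurable _ TG ((fun w => cell n (tau w)) @^-1` [set i]).
Proof. by apply: (@tau_measG [set x | cell n x = i]); exact: cell_measurable. Qed.

Lemma Hset_measG n (i : n.-tuple bool) t : @measurable _ TG (Hset i t).
Proof.
by apply: (@measurableI _ TG); [exact: cell_measG|exact: tau_le_measG].
Qed.

(** Finite so that the maximal inequality applies, increasing in [m] so that its bound passes to all
    rational times in [0, q[. *)
Definition times (q : R) (m : nat) : seq R :=
  [seq t <- [seq qn k | k <- iota 0 m] | 0 <= t < q].

Lemma timesP q m t : t \in times q m -> 0 <= t < q.
Proof. by rewrite mem_filter => /andP[]. Qed.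

Lemma times_mono q m n t : (m <= n)%N -> t \in times q m -> t \in times q n.
Proof.
move=> mn; rewrite !mem_filter => /andP[-> /mapP[k]]; rewrite mem_iota add0n => km ->.
by apply/mapP; exists k => //; rewrite mem_iota add0n (leq_trans km).
Qed.

Lemma times_ratr q (r : rat) : 0 <= (ratr r : R) < q -> ratr r \in times q (pickle r).+1.
Proof.
move=> h; rewrite mem_filter h andTb; apply/mapP; exists (pickle r); last by rewrite qn_ratr.
by rewrite mem_iota leq0n add0n ltnSn.
Qed.

(** * Ratio estimates on a fixed partition *)

Section level.
Variables (n : nat) (A H : n.-tuple bool -> R -> Omega -> R).
Hypotheses (vA : forall i, cond_version (A i) (Aset i))
  (vH : forall i, cond_version (H i) (Hset i)).

Local Notation c w := (cell n (tau w)).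

(* Given [F_oo] and the cell, [A t] is the conditional distribution function of
   the stopping time, here evaluated at the stopping time itself. *)
Lemma late_ratio_small (l N : R) : 0 < l -> 0 <= N -> smallG l [set w : TG | exists t,
  [/\ 0 <= t, t < N, (tau w <= t%:E)%E, L t w & A (c w) t w < l * H (c w) N w]].
Proof.
move=> l0 N0; have l0' := ltW l0.
pose D i t := [set w | A i t w < l * H i N w].
have FD i t : 0 <= t -> Finf (D i t).
  move=> t0; apply: meas_wrt_lt; first exact: sigma_Finf.
    exact: version_Finf (vA i) t0.
  apply: meas_wrtZ; first exact: sigma_Finf.
  exact: version_Finf (vH i) N0.
pose X m := [set w : TG | exists2 t, t \in times N m &
  ((tau w <= t%:E)%E /\ L t w) /\ D (c w) t w].
have step m : measurable (X m) /\ (Q' (X m) <= l%:E * Q' setT)%E.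
  have ev (i : n.-tuple bool) :
      measurable (setT `&` [set w : TG | exists2 t, t \in times N m & Aset i t w /\ D i t w]) /\
      (Q' (setT `&` [set w : TG | exists2 t, t \in times N m & Aset i t w /\ D i t w]) <=
       l%:E * Q' (setT `&` (fun w => c w) @^-1` [set i]))%E.
    apply: (@maximal_seq _ _ TG Q' Finf) => //.
    - exact: sigma_Finf.
    - exact: Finf_measG.
    - exact: cell_measG.
    - move=> t /timesP/andP[t0 _]; apply: (@measurableI _ TG); first exact: Hset_measG.
      exact: L_measG.
    - by move=> t /timesP/andP[t0 _]; exact: FD.
    - move=> u t /timesP/andP[u0 _] _ ut; apply: setISS; first exact: Hset_mono.
      exact: Lmono.
    (* On [C] the measure of [Aset i t] is the integral of [A i t], at most [l] times that of
       [H i N], hence at most [l] times the measure of the cell in [C]. *)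
    - move=> t C /timesP/andP[t0 tN] FC CD.
      have mC := Finf_measG FC.
      have [_ _ _ A01 AC] := vA i; have [_ _ _ H01 HC] := vH i.
      rewrite -(AC t t0 C FC).
      apply: (@le_trans _ _ (l%:E * \int[Q']_(x in C) (H i N x)%:E)%E).
        apply: integral_leZ => //;
          [exact: version_measG (vA i) t0|exact: version_measG (vH i) N0| | |].
        + by move=> w; case/andP: (A01 t w).
        + by move=> w; case/andP: (H01 N w).
        + by move=> w /CD/ltW.
      rewrite (HC N N0 C FC) lee_pmul2l//; apply: le_measure; rewrite ?inE.
      + by apply: measurableI => //; exact: Hset_measG.
      + by apply: measurableI => //; exact: cell_measG.
      + by move=> w [[wi _] Cw]; split.
    - by apply/(sdefT Finf setT); apply: sdef_cst; exact: sigma_Finf.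
  have XE : X m = \bigcup_(i in [set: n.-tuple bool])
      [set w : TG | exists2 t, t \in times N m & Aset i t w /\ D i t w].
    apply/seteqP; split=> w /=.
      by move=> [t ts [[tt Lt] Dt]]; exists (c w) => //; exists t.
    by move=> [i _ [t ts [[[wi tt] Lt] Dt]]]; exists t => //; rewrite wi.
  have mX : measurable (X m).
    rewrite XE; apply: fin_bigcup_measurable; first exact: finite_finset.
    by move=> i _; have [+ _] := ev i; rewrite setTI.
  split=> //; apply: (@fiber_le _ _ TG Q' _ (fun w => c w)) => // i.
    exact: cell_measG.
  have [me Pe] := ev i; apply: le_trans Pe; apply: le_measure; rewrite ?inE//.
    by apply: measurableI => //; exact: cell_measG.
  move=> w [[t ts [[tt Lt] Dt]] /= wi]; split=> //; exists t => //; split.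
    by split.
  by rewrite -wi.
have Xs m : smallG l (X m).
  have [mX PX] := step m; exists (X m); split=> //.
  by move: PX; rewrite [X in (_ <= _ * X)%E -> _]probability_setT mule1.
have Xinc m k w : (m <= k)%N -> X m w -> X k w.
  by move=> mk [t ts h]; exists t => //; exact: times_mono ts.
apply: smallS (small_incr Xs Xinc) => w [t [t0 tN tt Lt AH]].
(* By right-continuity of [A] the strict inequality survives at a slightly later rational time. *)
have [_ _ Arc _ _] := vA (c w).
have [q [tq hq]] := Arc w t _ AH.
have tqN : t < Num.min q N by rewrite lt_min tq.
have [r /andP[tr]] := rat_between tqN; rewrite lt_min => /andP[rq rN].
have r0 : 0 <= ratr r :> R by rewrite (le_trans t0)// ltW.
exists (pickle r).+1, (ratr r); first by apply: times_ratr; rewrite r0.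
split; last exact: hq.
split; first by rewrite (le_trans tt)// lee_fin ltW.
by apply: Lmono Lt => //; exact: ltW.
Qed.

(* Off [L q] the ratio is an average over [tau <= t] of a function which is small
   in L1, the set [b] being constant on the cells. *)
Lemma early_ratio_small (l e q : R) (b : n.-tuple bool -> set Omega) : 0 < l -> 0 <= q ->
  (forall i, Finf (b i)) -> smallG e [set w : TG | ~ (L q w <-> b (c w) w)] ->
  smallG (e + l^-1 * e) [set w : TG | exists t,
    [/\ 0 <= t, t < q, (tau w <= t%:E)%E, ~ L q w & l * H (c w) t w < A (c w) t w]].
Proof.
move=> l0 q0 Fb sb; have li0 : 0 < l^-1 by rewrite invr_gt0.
pose D i t := [set w | l * H i t w < A i t w].
have FD i t : 0 <= t -> Finf (D i t).
  move=> t0; apply: meas_wrt_lt; first exact: sigma_Finf.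
    apply: meas_wrtZ; first exact: sigma_Finf.
    exact: version_Finf (vH i) t0.
  exact: version_Finf (vA i) t0.
have mb i : @measurable _ TG (b i) by exact: Finf_measG.
pose X m := [set w : TG | exists2 t, t \in times q m &
  (tau w <= t%:E)%E /\ (D (c w) t w /\ ~ b (c w) w)].
(* The part of [L q] missed by the approximation; it lies in the error set, so its measure is at
   most [e]. *)
pose Y := [set w : TG | L q w /\ ~ b (c w) w].
have YE : Y = \bigcup_(i in [set: n.-tuple bool])
    (L q `&` (~` b i `&` (fun w => c w) @^-1` [set i])).
  apply/seteqP; split=> w /=; first by move=> [Lq nb]; exists (c w).
  by move=> [i _ [Lq [nb /= ci]]]; split=> //; rewrite ci.
have mY : measurable Y.
  rewrite YE; apply: (@fin_bigcup_measurable _ TG); first exact: finite_finset.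
  move=> i _; apply: measurableI; first exact: L_measG.
  by apply: measurableI; [exact: measurableC|exact: cell_measG].
have PY : (Q' Y <= e%:E)%E.
  have [E [mE DE PE]] := sb; apply: le_trans PE; apply: le_measure; rewrite ?inE//.
  by move=> w [Lq nb]; apply: DE => -[h _]; apply: nb; exact: h.
pose ev i m := [set w : TG | exists2 t, t \in times q m & Hset i t w /\ D i t w].
have step m : measurable (X m) /\ (Q' (X m) <= l^-1%:E * Q' Y)%E.
  have evP (i : n.-tuple bool) :
      @measurable _ TG (~` b i `&` ev i m) /\
      (Q' (~` b i `&` ev i m) <=
       l^-1%:E * Q' (~` b i `&` (L q `&` (fun w => c w) @^-1` [set i])))%E.
    apply: (@maximal_seq _ _ TG Q' Finf) => //.
    - exact: sigma_Finf.
    - exact: Finf_measG.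
    - exact: ltW.
    - by apply: measurableI; [exact: L_measG|exact: cell_measG].
    - by move=> t _; exact: Hset_measG.
    - by move=> t /timesP/andP[t0 _]; exact: FD.
    - by move=> u t _ _; exact: Hset_mono.
    (* Here [H] is dominated by [l^-1 * A] on [C], and [A i t] integrates to the measure of an event
       contained in [L q] because [t < q]. *)
    - move=> t C /timesP/andP[t0 tq] FC CD.
      have mC := Finf_measG FC.
      have [_ _ _ A01 AC] := vA i; have [_ _ _ H01 HC] := vH i.
      rewrite -(HC t t0 C FC).
      apply: (@le_trans _ _ (l^-1%:E * \int[Q']_(x in C) (A i t x)%:E)%E).
        apply: integral_leZ => //; [exact: ltW|exact: version_measG (vH i) t0|
          exact: version_measG (vA i) t0| | |].
        + by move=> w; case/andP: (H01 t w).
        + by move=> w; case/andP: (A01 t w).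
        + by move=> w /CD/ltW; rewrite ler_pdivlMl.
      rewrite (AC t t0 C FC) lee_pmul2l//; apply: le_measure; rewrite ?inE.
      + apply: measurableI => //; apply: (@measurableI _ TG); first exact: Hset_measG.
        exact: L_measG.
      + by apply: measurableI => //; apply: measurableI; [exact: L_measG|exact: cell_measG].
      + move=> w [[[wi _] Lt] Cw]; split=> //; split=> //.
        by apply: Lmono Lt => //; exact: ltW.
    - apply/(sdefT Finf (~` b i)); apply: sdef_not; first exact: sigma_Finf.
      by apply/sdefT; exact: Fb.
  have XE : X m = \bigcup_(i in [set: n.-tuple bool])
      (~` b i `&` ev i m).
    apply/seteqP; split=> w /=.
      by move=> [t ts [tt [Dt nb]]]; exists (c w) => //; split=> //; exists t.
    by move=> [i _ [nb [t ts [[wi tt] Dt]]]]; exists t => //; rewrite wi.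
  have mX : measurable (X m).
    rewrite XE; apply: fin_bigcup_measurable; first exact: finite_finset.
    by move=> i _; have [] := evP i.
  split=> //; apply: (@fiber_le _ _ TG Q' _ (fun w => c w)) => //.
  - exact: ltW.
  - by move=> i; exact: cell_measG.
  move=> i; have [me Pe] := evP i.
  have mYi : measurable (Y `&` (fun w => c w) @^-1` [set i]).
    by apply: measurableI => //; exact: cell_measG.
  apply: (@le_trans _ _ (Q' (~` b i `&` ev i m))).
    apply: le_measure; rewrite ?inE//.
      by apply: measurableI => //; exact: cell_measG.
    move=> w [[t ts [tt [Dt nb]]] /= wi]; rewrite wi in Dt nb.
    by split=> //; exists t.
  apply: le_trans Pe _; rewrite lee_pmul2l//; apply: le_measure; rewrite ?inE//.
    apply: measurableI; first exact: measurableC.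
    by apply: measurableI; [exact: L_measG|exact: cell_measG].
  by move=> w [nb [Lq /= wi]]; split=> //; split=> //; rewrite wi.
have Xs m : smallG (l^-1 * e) (X m).
  have [mX PX] := step m; exists (X m); split=> //.
  by rewrite (le_trans PX)// EFinM lee_pmul2l.
have Xinc m k w : (m <= k)%N -> X m w -> X k w.
  by move=> mk [t ts h]; exists t => //; exact: times_mono ts.
apply: smallS (smallU sb (small_incr Xs Xinc)) => w [t [t0 tq tt nL HA]].
(* The term [e] pays for the points outside [L q] where [b] holds; at the others the maximal bound
   [l^-1 * e] applies. *)
have [bw|nb] := pselect (b (c w) w); first by left=> -[_ /(_ bw)].
right.
have [_ Amono _ _ _] := vA (c w); have [_ _ Hrc _ _] := vH (c w).
have HA' : H (c w) t w < l^-1 * A (c w) t w by rewrite ltr_pdivlMl.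
have [q' [tq' hq']] := Hrc w t _ HA'.
have tqN : t < Num.min q' q by rewrite lt_min tq'.
have [r /andP[tr]] := rat_between tqN; rewrite lt_min => /andP[rq' rq].
have r0 : 0 <= ratr r :> R by rewrite (le_trans t0)// ltW.
exists (pickle r).+1, (ratr r); first by apply: times_ratr; rewrite r0.
split; first by rewrite (le_trans tt)// lee_fin ltW.
split=> //; rewrite /D /=.
apply: (@lt_le_trans _ _ (A (c w) t w)); last by apply: Amono; exact: ltW.
by have := hq' _ rq'; rewrite ltr_pdivlMl.
Qed.

(** Over the event [H i N <= 0] of [Finf], the function [H i N] integrates to 0. Positivity is what
    makes a comparison of two levels of the ratio strict. *)
Lemma H_pos_ae (N : R) : 0 <= N ->
  Q'.-negligible [set w : TG | (tau w <= N%:E)%E /\ H (c w) N w <= 0].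
Proof.
move=> N0.
apply: (@negligibleS _ _ _ _ [set w : TG | exists i, Hset i N w /\ H i N w <= 0]).
  by move=> w [tN H0]; exists (c w).
apply: negligible_ex => i.
have [_ _ _ H01 HC] := vH i.
have FC : Finf [set w | H i N w <= 0].
  have := version_Finf (vH i) N0 (measurable_itv `]-oo, 0]).
  by congr Finf; apply/seteqP; split=> w /=; rewrite in_itv.
have mC := Finf_measG FC.
apply/negligibleP.
  by apply: (@measurableI _ TG); [exact: Hset_measG|].
transitivity (Q' (Hset i N `&` [set w | H i N w <= 0])) => //.
rewrite -(HC N N0 _ FC).
apply/eqP; rewrite eq_le; apply/andP; split; last first.
  by apply: integral_ge0 => w _; rewrite lee_fin; case/andP: (H01 N w).
rewrite (eq_integral (fun=> 0%E)) ?integral0// => w; rewrite inE /= => Hw.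
by congr EFin; apply: le_anti; rewrite Hw; case/andP: (H01 N w).
Qed.

End level.

(** One partition serves the first [k] rational times, so a single sequence of partitions can be
    fixed before any time is considered. *)
Lemma approx_level (e : R) (k : nat) : 0 < e -> exists m, forall n, (m <= n)%N ->
  forall j, (j < k)%N -> 0 <= (qn j : R) ->
  exists b : n.-tuple bool -> set Omega, (forall i, Finf (b i)) /\
    smallG e [set w : TG | ~ (L (qn j) w <-> b (cell n (tau w)) w)].
Proof.
move=> e0; elim: k => [|k [m IH]]; first by exists 0%N.
have [k0|k0] := leP 0 (qn k : R); last first.
  exists m => n mn j; rewrite ltnS leq_eqVlt => /orP[/eqP-> |]; last exact: IH.
  by rewrite leNgt k0.
have [m' hm'] := measG_approximable (L_measG k0) e0.
exists (maxn m m') => n; rewrite geq_max => /andP[mn m'n] j.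
rewrite ltnS leq_eqVlt => /orP[/eqP-> _|]; last exact: IH.
exact: hm'.
Qed.

Lemma detection : exists V : \bar R * (R * Omega) -> Prop, defBO V /\
  Q'.-negligible [set w : TG | exists t, [/\ 0 <= t, (tau w <= t%:E)%E &
    ~ (L t w <-> (exists r : rat, [/\ 0 <= ratr r :> R, ratr r < t & L (ratr r) w]) \/
        V (tau w, (t, w)))]].
Proof.
have sO := sigma_optional F; have sB := sigma_borel_optional F.
(* One factor absorbs the loss 2^p of the weak-type bound as soon as [k >= p]; the other is left to
   be summed. *)
pose e (k : nat) : R := 2^-1 ^+ k * 2^-1 ^+ k.
have h0 k : 0 < 2^-1 ^+ k :> R by rewrite exprn_gt0// invr_gt0.
have e0 k : 0 < e k by rewrite mulr_gt0.
have /choice[n hn] k := approx_level k (e0 k).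
pose H k (i : (n k).-tuple bool) := sval (cid (Hset_version i)).
pose A k (i : (n k).-tuple bool) := sval (cid (Aset_version i)).
have vH k (i : (n k).-tuple bool) : cond_version (H k i) (Hset i).
  by rewrite /H; case: cid.
have vA k (i : (n k).-tuple bool) : cond_version (A k i) (Aset i).
  by rewrite /A; case: cid.
(* Where [H] is positive, [V] says that the upper limit of the ratio is positive. Quantifying over
   the cell [i] leaves rectangles for fixed [p] and [k]. *)
pose V (q : \bar R * (R * Omega)) := exists p : nat, forall K : nat, exists k : nat,
  (K <= k)%N /\ exists i : (n k).-tuple bool, cell (n k) q.1 = i /\
    2^-1 ^+ p * H k i q.2.1 q.2.2 < A k i q.2.1 q.2.2.
exists V; split.
  apply: sdef_ex => // p; apply: sdef_all => // K; apply: sdef_ex => // k.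
  apply: sdef_guard => // _; apply: sdef_ex => // i.
  apply: (@defBO_rect [set x | cell (n k) x = i]
    (fun p' => 2^-1 ^+ p * H k i p'.1 p'.2 < A k i p'.1 p'.2)); first exact: cell_measurable.
  have [aH Hmono Hrc _ _] := vH k i; have [aA Amono Arc _ _] := vA k i.
  have cX := cadlag_subZ (2^-1 ^+ p) (mono_cadlag Amono Arc) (mono_cadlag Hmono Hrc).
  have aX : adapted F (fun t w => A k i t w - 2^-1 ^+ p * H k i t w).
    move=> t t0; apply/(meas_wrtP _ (sigma_F t0)); apply: measurable_funB.
      by apply/(meas_wrtP _ (sigma_F t0)); exact: aA.
    apply: measurable_funM; first exact: measurable_cst.
    by apply/(meas_wrtP _ (sigma_F t0)); exact: aH.
  apply: (sdef_ext _ (defO_cadlag cX aX (measurable_itv `]0, +oo[))) => q _.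
  by rewrite /= in_itv/= andbT subr_gt0.
pose c k w := cell (n k) (tau w).
(* [N3] collects the failures inside [L], where the ratio tends to 0 at a time of [L]. [N4] collects
   those outside: at infinitely many levels [k] some time before [qn j] has ratio above 2^-p. That
   time may vary with [k], which the maximal bound allows. *)
pose N3 (N : nat) := [set w : TG | exists t, [/\ 0 <= t, t < N%:R, (tau w <= t%:E)%E, L t w &
  forall p : nat, exists K : nat, forall k, (K <= k)%N ->
    A k (c k w) t w <= 2^-1 ^+ p * H k (c k w) t w]].
pose Z0 (N : nat) := [set w : TG | exists k,
  (tau w <= (N%:R : R)%:E)%E /\ H k (c k w) N%:R w <= 0].
pose N4 (p j : nat) := [set w : TG | 0 <= (qn j : R) /\
  forall K : nat, exists k : nat, (K <= k)%N /\ exists t,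
    [/\ 0 <= t, t < qn j, (tau w <= t%:E)%E, ~ L (qn j) w &
    2^-1 ^+ p * H k (c k w) t w < A k (c k w) t w]].
have nZ0 N : Q'.-negligible (Z0 N).
  by apply: negligible_ex => k; apply: H_pos_ae => //; exact: vH.
have nN3 N : Q'.-negligible (N3 N).
  apply: (@negligibleS _ _ _ _ (Z0 N `|` (N3 N `\` Z0 N))).
    by move=> w Nw; have [Zw|nZ] := pselect (Z0 N w); [left|right].
  apply: negligibleU => //; apply: small_negligible => l l0.
  (* With 2^-p below [l], the process [A] at [t] is eventually at most 2^-p times [H] at [N], hence
     strictly below [l] times it, since [H] at [N] is positive off [Z0]. *)
  have [p pl] : exists p : nat, 2^-1 ^+ p < l.
    have h : (fun p : nat => 2^-1 ^+ p : R) @ \oo --> (0 : R).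
      by apply: cvg_expr; rewrite ger0_norm ?invr_ge0// invf_lt1// ltr1n.
    move/cvgrPdist_lt/(_ _ l0): h => [p _ hp]; exists p.
    have := hp p (leqnn p : [set m | (p <= m)%N] p) => /=.
    by rewrite sub0r normrN => /(le_lt_trans (ler_norm _)).
  have N0 : 0 <= N%:R :> R by [].
  have sm k := late_ratio_small (vA k) (vH k) l0 N0.
  apply: smallS (small_liminf sm) => w [[t [t0 tN tt Lt h]] nZ].
  have [K hK] := h p; exists K => k Kk; exists t; split=> //.
  have [_ Hmono _ _ _] := vH k (c k w).
  have HN : 0 < H k (c k w) N%:R w.
    rewrite ltNge; apply/negP => HN; apply: nZ; exists k; split=> //.
    by rewrite (le_trans tt)// lee_fin ltW.
  apply: le_lt_trans (hK k Kk) _.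
  apply: (@le_lt_trans _ _ (2^-1 ^+ p * H k (c k w) N%:R w)).
    by rewrite ler_pM2l//; apply: Hmono; exact: ltW.
  by rewrite ltr_pM2r.
have nN4 p j : Q'.-negligible (N4 p j).
  apply: negligible_guard => q0.
  (* [k >= p] makes the weak-type loss harmless and [k > j] puts [qn j] among the times approximated
     at level [k]; the total error is then at most 2 * 2^-k. *)
  apply: (@small_limsup _ _ TG Q' 2 (maxn p j.+1)) => // k; rewrite geq_max => /andP[pk jk].
  have [b [Fb sb]] := hn k (n k) (leqnn _) j jk q0.
  apply: small_le (early_ratio_small (vA k) (vH k) (h0 p) q0 Fb sb).
  rewrite /e; have pk' : (2^-1 ^+ p)^-1 * (2^-1 ^+ k) <= 1 :> R.
    rewrite mulrC ler_pdivrMr// mul1r; apply: ler_wiXn2l => //.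
    by rewrite invf_le1// ler1n.
  have k1 : 2^-1 ^+ k <= 1 :> R by apply: exprn_ile1 => //; rewrite invf_le1// ler1n.
  rewrite mulrA -mulrDl ler_pM2r//; lra.
apply: (@negligibleS _ _ _ _ ([set w : TG | exists N, N3 N w] `|`
    [set w : TG | exists pj : nat * nat, N4 pj.1 pj.2 w])); last first.
  apply: negligibleU; first exact: negligible_ex.
  by apply: negligible_ex => -[p j]; exact: nN4.
move=> w [t [t0 tt h]]; apply: contrapT => nN; apply: h; split=> [Lt|].
  right; apply: contrapT => nV; apply: nN; left.
  exists (Num.truncn t).+1, t; split=> //; first exact: truncnS_gt.
  move=> p; apply: contrapT => nK; apply: nV; exists p => K.
  apply: contrapT => nk; apply: nK; exists K => k Kk.
  rewrite leNgt; apply/negP => HA; apply: nk; exists k; split=> //.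
  by exists (c k w).
move=> [[r [r0 /ltW rt Lr]]|[p hV]]; first exact: Lmono Lr.
apply: contrapT => nLt; apply: nN; right.
(* Right-continuity of [L] gives a later [s] still outside [L]; a rational between [t] and [s]
   supplies the index of [N4]. *)
have [s [ts nLs]] : exists s, t < s /\ ~ L s w.
  apply: contrapT => h; apply: nLt; apply: Lrc => // s ts.
  by apply: contrapT => nLs; apply: h; exists s.
have [r /andP[tr rs]] := rat_between ts.
have r0 : 0 <= ratr r :> R by rewrite (le_trans t0)// ltW.
exists (p, pickle r); rewrite /N4 /=; split; rewrite qn_ratr// => K.
have [k [Kk [i [ci HA]]]] := hV K; exists k; split=> //; exists t; split=> //.
  by move=> Lr; apply: nLs; apply: Lmono Lr => //; exact: ltW.
by rewrite /c ci.
Qed.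

Lemma splittable_incr : splittable [set p | L p.1 p.2].
Proof.
have sO := sigma_optional F; have sB := sigma_borel_optional F.
have [V [dV nV]] := detection.
have /choice[A' hA'] : forall r : rat, exists A', 0 <= ratr r :> R -> F (ratr r) A' /\
    Q'.-negligible [set w : TG | ((ratr r)%:E < tau w)%E /\ ~ (L (ratr r) w <-> A' w)].
  move=> r; have [r0|r0] := leP 0 (ratr r : R); last by exists set0.
  by have [A' hA'] := G_before_tau r0 (GL r0); exists A'.
(* Increasing and right-continuous by construction, whatever sets [A' r] were chosen; before [tau]
   it agrees with [L] almost surely. *)
pose U t := [set w : Omega | forall s : rat, t < ratr s ->
  exists r : rat, (0 <= ratr r :> R /\ (ratr r : R) < ratr s) /\ A' r w].
have dU : defO (fun p => U p.1 p.2).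
  apply: defO_incr => [t t0|s t st w h q tq|t w h s ts].
  - rewrite (hFrc t0) => s0 /=; rewrite in_itv/= andbT => ts0.
    have s00 : 0 <= s0 by rewrite (le_trans t0)// ltW.
    have sF := sigma_F s00.
    apply/sdefT; apply: (@sdef_ext _ _ _ (fun w => forall s : rat,
        (t < ratr s /\ ratr s < s0) ->
        exists r : rat, (0 <= ratr r :> R /\ (ratr r : R) < ratr s) /\ A' r w)) => [w _|].
      split=> h s; last by move=> [ts _]; exact: h.
      move=> ts; have tm : t < Num.min (ratr s) s0 by rewrite lt_min ts.
      have [s' /andP[ts']] := rat_between tm; rewrite lt_min => /andP[s's s's0].
      have [r [[r0 rs'] Ar]] := h s' (conj ts' s's0).
      by exists r; split=> //; split=> //; exact: lt_trans s's.
    apply: sdef_all => // s; apply: sdef_guard_imply => // -[ts ss0].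
    apply: sdef_ex => // r; apply: sdef_guard => // -[r0 rs].
    apply/sdefT; apply: (F_mono r0 (ltW (lt_trans rs ss0))).
    by case: (hA' r r0).
  - by apply: h; exact: le_lt_trans tq.
  - have [s' /andP[ts' s's]] := rat_between ts.
    have [r [[r0 rs'] Ar]] := h _ ts' s s's.
    by exists r; split.
have /choice[C /choice[B hC]] : forall r : rat, exists C B, 0 <= ratr r :> R ->
    [/\ Cfilt (ratr r) C, J B, Q B = 0%E & forall w, ~ B w -> (L (ratr r) w <-> C w)].
  move=> r; have [r0|r0] := leP 0 (ratr r : R); last by exists set0, set0.
  by have [C [B h]] := G_modnull (GL r0); exists C, B.
have /choice[D hD] : forall rs : rat * rat, exists D : \bar R -> Omega -> Prop,
    (0 <= ratr rs.1 :> R /\ (ratr rs.1 : R) < ratr rs.2) ->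
    defBO (fun q => ratr rs.2 < q.2.1 /\ D q.1 q.2.2) /\ forall w, C rs.1 w <-> D (tau w) w.
  move=> [r s] /=.
  have [[r0 rs]|nrs] := pselect (0 <= ratr r :> R /\ (ratr r : R) < ratr s); last first.
    by exists (fun _ _ => False).
  have s0 : 0 <= ratr s :> R by rewrite (le_trans r0)// ltW.
  have [/CfiltE/(_ _ rs) jC _ _ _] := hC r r0.
  by have [D hD] := defBO_after s0 jC; exists D.
(* The part known strictly before [t]. A rational [s] is inserted because an event of
   [Cfilt (ratr r)] can be read from [tau] and [F] only at times after [ratr r]. *)
pose W (q : \bar R * (R * Omega)) := exists rs : rat * rat,
  (0 <= ratr rs.1 :> R /\ (ratr rs.1 : R) < ratr rs.2) /\ (ratr rs.2 < q.2.1 /\ D rs q.1 q.2.2).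
have dW : defBO W.
  apply: sdef_ex => // rs; apply: sdef_guard => // hrs.
  by case: (hD rs hrs).
have [OS'] := dU; have [BS''] := sdef_or sB dW dV.
exists [set x | timedom x /\ U x.1 x.2], [set x | ext_timedom x /\ (W x \/ V x)]; split=> //.
apply: (@negligibleS _ _ _ _ (([set w : TG | exists r : rat, 0 <= ratr r :> R /\
      (((ratr r)%:E < tau w)%E /\ ~ (L (ratr r) w <-> A' r w))] `|`
    [set w : TG | exists r : rat, 0 <= ratr r :> R /\ B r w]) `|`
    [set w : TG | exists t, [/\ 0 <= t, (tau w <= t%:E)%E &
    ~ (L t w <-> (exists r : rat, [/\ 0 <= ratr r :> R, ratr r < t & L (ratr r) w]) \/
        V (tau w, (t, w)))]])); last first.
  apply: negligibleU => //; apply: negligibleU;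
    apply: negligible_ex => r; apply: negligible_guard => r0.
    by case: (hA' r r0).
  by have [_ JB QB _] := hC r r0; exact: J_negligible.
move=> w [t [t0 h]]; apply: contrapT => nN; apply: h.
have n1 (r : rat) : 0 <= ratr r :> R -> ((ratr r)%:E < tau w)%E -> L (ratr r) w <-> A' r w.
  move=> r0 rw; apply: contrapT => nLA; apply: nN; left; left; exists r; split=> //.
have n2 (r : rat) : 0 <= ratr r :> R -> L (ratr r) w <-> C r w.
  move=> r0; have [_ _ _ ] := hC r r0; apply=> Br; apply: nN; left; right.
  by exists r.
case: ifPn => [tw|].
  (* When [t < tau], rational times close enough to the right of [t] still precede [tau], so the
     traces [A' r] decide [L] there. *)
  have between s : t < s -> exists r : rat, [/\ t < ratr r, (ratr r : R) < s, 0 <= ratr r :> R &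
      ((ratr r)%:E < tau w)%E].
    move=> ts; have [u [tu us uw]] : exists u, [/\ t < u, u <= s & (u%:E <= tau w)%E].
      case: (tau w) tw => [x| |//] => [tx|_]; last by exists s; rewrite leey.
      rewrite lte_fin in tx; exists (Num.min x s).
      by rewrite lt_min tx ts lee_fin !ge_min !lexx orbT.
    have [r /andP[tr ru]] := rat_between tu; exists r; split=> //.
    - exact: lt_le_trans us.
    - by rewrite (le_trans t0)// ltW.
    - by rewrite (lt_le_trans _ uw)// lte_fin.
  split=> [Lt|[_ Ut]].
    split=> // s ts; have [r [tr rs r0 rw]] := between _ ts.
    by exists r; split=> //; apply/n1 => //; apply: Lmono Lt => //; exact: ltW.
  apply: Lrc => // s ts; have [r' [tr' r's r'0 r'w]] := between _ ts.
  have [r [[r0 rr'] Ar]] := Ut r' tr'.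
  apply: (Lmono r0 (ltW (lt_trans rr' r's))); apply/n1 => //.
  by rewrite (lt_trans _ r'w)// lte_fin.
rewrite -leNgt => tt.
have n3 : L t w <-> (exists r : rat, [/\ 0 <= ratr r :> R, ratr r < t & L (ratr r) w]) \/
        V (tau w, (t, w)).
  by apply: contrapT => n; apply: nN; right; exists t.
rewrite [X in X <-> _]n3; split=> [h|[_ h]].
  split; first by split=> //=; exact: htau_pos.
  case: h => [[r [r0 rt Lr]]|]; [left|by right].
  have [s /andP[rs st]] := rat_between rt.
  have hrs : 0 <= ratr r :> R /\ (ratr r : R) < ratr s by [].
  exists (r, s); split=> //; split=> //.
  by apply/(hD (r, s) hrs).2; apply/n2.
case: h => [[[r s] /= [hrs [st Dw]]]|]; [left|by right].
exists r; split; [exact: hrs.1|exact: lt_trans hrs.2 st|].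
by apply/(n2 r hrs.1)/(hD (r, s) hrs).2.
Qed.

End stopping_family.

(** * Cadlag processes *)

Local Notation defS := (sdef timedom splittable).

Lemma defS_incr (L : R -> set Omega) : (forall t, 0 <= t -> G t (L t)) ->
  (forall s t, 0 <= s -> s <= t -> L s `<=` L t) ->
  (forall t w, 0 <= t -> (forall s, t < s -> L s w) -> L t w) ->
  defS (fun p => L p.1 p.2).
Proof.
move=> GL Lmono Lrc.
have [S' [S'' [OS BS neg]]] := splittable_incr GL Lmono Lrc.
constructor; exists S', S''; split=> //.
apply: negligibleS neg => w [t [t0 h]]; exists t; split=> // h'; apply: h.
by apply: iff_trans h'; split=> [[]|].
Qed.

(** The case of the stopping time equal to [u] on [A] and infinite elsewhere. *)
Lemma defS_ge u (A : set Omega) : 0 <= u -> G u A -> defS (fun p => u <= p.1 /\ A p.2).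
Proof.
move=> u0 GA; apply: (@defS_incr (fun t => [set w | u <= t /\ A w])).
- move=> t t0; apply/sdefT; apply: sdef_guard; first exact: sigma_G.
  by move=> ut; apply/sdefT; exact: G_mono GA.
- by move=> s t _ st w [us Aw]; split=> //; exact: le_trans st.
- move=> t w t0 h; have [_ Aw] := h (t + 1) (ltr_pwDr ltr01 (lexx _)).
  split=> //; apply/ler_addgt0Pr => e e0.
  by have [] := h (t + e) (ltr_pwDr e0 (lexx _)).
Qed.

Lemma defS_gt u (A : set Omega) : 0 <= u -> G u A -> defS (fun p => u < p.1 /\ A p.2).
Proof.
move=> u0 GA.
apply: (@sdef_ext _ _ _ (fun p : R * Omega => exists r : rat, u < ratr r /\
    ((ratr r : R) <= p.1 /\ A p.2))) => [[t w] _ /=|].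
  split=> [[r [ur [rt Aw]]]|[/rat_between[r /andP[ur rt]] Aw]].
    by split=> //; exact: lt_le_trans rt.
  by exists r; rewrite ur ltW.
apply: sdef_ex; first exact: sigma_splittable.
move=> r; apply: sdef_guard; first exact: sigma_splittable.
move=> ur; apply: defS_ge; first by rewrite (le_trans u0)// ltW.
exact: G_mono (ltW ur) _ GA.
Qed.

Lemma defS_time u : 0 <= u -> defS (fun p => u < p.1).
Proof.
move=> u0; have GT : G u setT by apply/(sdefT (G u) setT); apply: sdef_cst; exact: sigma_G.
by apply: (sdef_ext _ (defS_gt u0 GT)) => p _; split=> [[]|].
Qed.

Section cadlag_process.
Variable X : R -> Omega -> R.
Hypotheses (cX : cadlag X) (aX : adapted G X).

Lemma cadlag_right_gt t w a : 0 <= t -> a < X t w ->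
  exists u, t < u /\ forall s, t <= s -> s < u -> a < X s w.
Proof.
move=> t0 aXt; have [h _] := cX w t0.
have [e /= e0 he] : nbhs_ball t (fun s => t < s -> a < X s w).
  by apply/nbhs_ballP; exact: (cvgr_gt _ h _ aXt).
exists (t + e); split; first by rewrite ltrDl.
move=> s; rewrite le_eqVlt => /orP[/eqP<- //|ts] se.
by apply: he => //; rewrite -ball_normE /= distrC ger0_norm ?subr_ge0 ?ltrBlDl// ltW.
Qed.

Lemma X_gt_G t a : 0 <= t -> G t [set w | a < X t w].
Proof.
move=> t0; have := aX t0 (measurable_itv `]a, +oo[).
by congr (G t); apply/seteqP; split=> w /=; rewrite in_itv/= andbT.
Qed.

Definition debut (r a t : R) : set Omega :=
  [set w | r <= t /\ forall s, t < s -> exists q, (r <= q /\ q < s) /\ a < X q w].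

(** By [G_rc] it suffices to look up to each [s0 > t]; right-continuity of [X] then moves the
    witness [q] to a rational one. *)
Lemma debut_G r a t : 0 <= r -> 0 <= t -> G t (debut r a t).
Proof.
move=> r0 t0; apply: G_rc => // s0 ts0.
have sG := sigma_G s0.
apply/sdefT; apply: sdef_guard => // rt.
apply: (@sdef_ext _ _ _ (fun w => forall s : rat, (t < ratr s /\ ratr s < s0) ->
    exists q : rat, (r <= ratr q /\ (ratr q : R) < ratr s) /\ a < X (ratr q) w)) => [w _|].
  split=> h s.
    move=> ts; have tm : t < Num.min s s0 by rewrite lt_min ts.
    have [s' /andP[ts']] := rat_between tm; rewrite lt_min => /andP[s's s's0].
    have [q [[rq qs'] aq]] := h s' (conj ts' s's0).
    by exists (ratr q); split=> //; split=> //; exact: lt_trans s's.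
  move=> [ts ss0]; have [q [[rq qs] aq]] := h _ ts.
  have [u [qu hu]] := cadlag_right_gt (le_trans r0 rq) aq.
  have qm : q < Num.min u (ratr s) by rewrite lt_min qu.
  have [q' /andP[qq']] := rat_between qm; rewrite lt_min => /andP[q'u q's].
  exists q'; split; last by apply: hu => //; exact: ltW.
  by split=> //; rewrite (le_trans rq)// ltW.
apply: sdef_all => // s; apply: sdef_guard_imply => // -[ts ss0].
apply: sdef_ex => // q; apply: sdef_guard => // -[rq qs].
apply/sdefT; apply: (G_mono (ltW (lt_trans qs ss0))).
by apply: X_gt_G; exact: le_trans rq.
Qed.

Lemma debut_mono r a s t : s <= t -> debut r a s `<=` debut r a t.
Proof.
move=> st w [rs h]; split; first exact: le_trans st.
by move=> u tu; apply: h; exact: le_lt_trans tu.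
Qed.

Lemma debut_rc r a t w : (forall s, t < s -> debut r a s w) -> debut r a t w.
Proof.
move=> h; split.
  by apply/ler_addgt0Pr => e e0; have [] := h (t + e) (ltr_pwDr e0 (lexx _)).
move=> s ts; have [s' /andP[ts' s's]] := rat_between ts.
by have [_] := h _ ts'; apply.
Qed.

(* [debut r a t] says that [X] gets above [a] between [r] and [t] or just after
   [t]; [hit r a t] that [t] is the first such time. *)
Definition hit (r a t : R) (w : Omega) := debut r a t w /\
  ~ exists s : rat, 0 <= ratr s :> R /\ (ratr s < t /\ debut r a (ratr s) w).

Lemma defS_hit r a : 0 <= r -> defS (fun p => hit r a p.1 p.2).
Proof.
move=> r0; have sS := sigma_splittable; apply: sdef_and => //.
  apply: defS_incr => [t t0|s t _|t w _]; [exact: debut_G|exact: debut_mono|exact: debut_rc].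
apply: sdef_not => //; apply: sdef_ex => // s; apply: sdef_guard => // s0.
by apply: defS_gt => //; exact: debut_G.
Qed.

Lemma hit_intro r a t w : r <= t -> (forall s, r <= s -> s < t -> X s w <= a) ->
  a < X t w -> hit r a t w.
Proof.
move=> rt le_a aXt; split; first by split=> // s ts; exists t.
move=> [s [s0 [st [rs h]]]]; have [q [[rq qt]]] := h t st.
by apply/negP; rewrite -leNgt; exact: le_a.
Qed.

End cadlag_process.

Lemma cadlagN (X : R -> Omega -> R) : cadlag X -> cadlag (fun t w => - X t w).
Proof.
move=> cX w t t0; have [h1 h2] := cX w t t0; split; first exact: cvgN.
by move=> tgt0; apply: is_cvgN; exact: h2.
Qed.

Lemma adaptedN (X : R -> Omega -> R) : adapted G X -> adapted G (fun t w => - X t w).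
Proof.
move=> aX t t0; apply/(meas_wrtP _ (sigma_G t)).
by apply: measurableT_comp => //; apply/(meas_wrtP _ (sigma_G t)); exact: aX.
Qed.

(** If [X t w < a], right-continuity excludes witnesses at or just after [t], so one lies before
    [t], and a rational between it and [t] contradicts that [t] is the first time. The inequality is
    weak because [X] may exceed [a] only just after [t]. *)
Lemma hit_le (X : R -> Omega -> R) r a t w : cadlag X -> 0 <= r -> 0 <= t ->
  hit X r a t w -> a <= X t w.
Proof.
move=> cX r0 t0 [[rt h] nh]; rewrite leNgt; apply/negP => Xa.
have Na : - a < - X t w by rewrite ltrN2.
have [u [tu hu]] := cadlag_right_gt (cadlagN cX) t0 Na.
have [q [[rq qu] aq]] := h u tu.
have [tq|qt] := leP t q.
  by have := hu q tq qu; rewrite ltrN2 => /(lt_trans aq); rewrite ltxx.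
have [s /andP[qs st]] := rat_between qt.
have s0 : 0 <= ratr s :> R by rewrite (le_trans r0)// (le_trans rq)// ltW.
apply: nh; exists s; split=> //; split=> //; split.
  by rewrite (le_trans rq)// ltW.
by move=> s' ss'; exists q; split=> //; split=> //; exact: lt_trans ss'.
Qed.

Lemma cadlag_left_gt (X : R -> Omega -> R) t w (x a : R) : 0 < t ->
  X^~ w s @[s --> t^'-] --> x -> a < x ->
  exists u, [/\ 0 <= u, u < t & forall s, u < s -> s < t -> a < X s w].
Proof.
move=> t0 h ax; have [e /= e0 he] : nbhs_ball t (fun s => s < t -> a < X s w).
  by apply/nbhs_ballP; exact: (cvgr_gt _ h _ ax).
exists (Num.max 0 (t - e)); split; first by rewrite le_max lexx.
  by rewrite gt_max t0 ltrBlDr ltrDl.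
move=> s; rewrite gt_max => /andP[_ es] st; apply: he => //.
by rewrite -ball_normE /= ger0_norm ?subr_ge0 1?ltW// ltrBlDl -ltrBlDr.
Qed.

(** Only rational parameters, hits at [t] and values at rational times before [t] occur, and all of
    these split. The clauses describe an arrival above [c] at [t], and a path already above [c] that
    does not fall at [t]. *)
Definition above (X : R -> Omega -> R) (c t : R) (w : Omega) :=
  (exists ar : rat * rat, (c < ratr ar.1 /\ 0 <= ratr ar.2 :> R) /\
     (ratr ar.2 < t /\ hit X (ratr ar.2) (ratr ar.1) t w)) \/
  (exists b : rat, c < ratr b /\
     ((exists r0 : rat, 0 <= ratr r0 :> R /\ (ratr r0 < t /\
         forall q : rat, (ratr r0 : R) < ratr q -> (ratr q < t -> ratr b < X (ratr q) w))) /\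
      forall r : rat, 0 <= ratr r :> R -> (ratr r < t ->
        ~ hit (fun t w => - X t w) (ratr r) (- ratr b) t w))).

(* A jump across [c] is a hit at time [t]; without it [X t w] is on the same side
   of [c] as the left limit. *)
Lemma cadlag_gtE (X : R -> Omega -> R) t w (c : R) : cadlag X -> 0 < t ->
  c < X t w <-> above X c t w.
Proof.
move=> cX t0; have t0' := ltW t0; split; last first.
  move=> [[[a r] /= [[ca r0] [rt ht]]]|[b [cb [[r0 [r00 [r0t hq]]] hr]]]].
    by apply: lt_le_trans ca _; exact: hit_le ht.
  (* Otherwise [- X] would exceed [- ratr b] for the first time at [t]: to the left, [X >= ratr b]
     extends from rational to all times by right-continuity. *)
  rewrite ltNge; apply/negP => Xc.
  have Xb : X t w < ratr b by exact: le_lt_trans cb.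
  have [r /andP[r0r rt]] := rat_between r0t.
  have r_ge0 : 0 <= ratr r :> R by rewrite (le_trans r00)// ltW.
  apply: (hr r r_ge0 rt); apply: hit_intro; [exact: ltW| |by rewrite ltrN2].
  move=> s rs st; rewrite lerN2 leNgt; apply/negP => Xsb.
  have s0 : 0 <= s by exact: le_trans rs.
  have Nb : - ratr b < - X s w by rewrite ltrN2.
  have [u [su hu]] := cadlag_right_gt (cadlagN cX) s0 Nb.
  have sm : s < Num.min u t by rewrite lt_min su.
  have [q /andP[sq]] := rat_between sm; rewrite lt_min => /andP[qu qt].
  have := hu _ (ltW sq) qu; rewrite ltrN2; apply/negP; rewrite -leNgt ltW//.
  apply: hq => //; exact: lt_trans r0r (le_lt_trans rs sq).
move=> cXt; have [_ /(_ t0)/cvg_ex[x /= hx]] := cX w t t0'.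
(* If the left limit is at most [c], the path is below some [ratr a > c] just before [t] and exceeds
   it at [t]. If not, a rational [b] above [c] and below both the left limit and [X t w] witnesses
   the second clause. *)
have [xc|cx] := leP x c.
  left; have [a /andP[ca aX]] := rat_between cXt.
  have hNx : (fun s => - X s w) s @[s --> t^'-] --> - x by exact: cvgN.
  have ax : - ratr a < - x by rewrite ltrN2; exact: le_lt_trans ca.
  have [u [u0 ut hu]] := @cadlag_left_gt (fun t w => - X t w) t w _ _ t0 hNx ax.
  have [r /andP[ur rt]] := rat_between ut.
  have r0 : 0 <= ratr r :> R by rewrite (le_trans u0)// ltW.
  exists (a, r) => /=; split=> //; split=> //; apply: hit_intro => //; first exact: ltW.
  move=> s rs st; have := hu s (lt_le_trans ur rs) st; rewrite ltrN2; exact: ltW.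
right; have cm : c < Num.min x (X t w) by rewrite lt_min cx.
have [b /andP[cb]] := rat_between cm; rewrite lt_min => /andP[bx bX].
exists b; split=> //; split.
  have [u [u0 ut hu]] := cadlag_left_gt t0 hx bx.
  have [r /andP[ur rt]] := rat_between ut.
  exists r; split; first by rewrite (le_trans u0)// ltW.
  by split=> // q rq qt; apply: hu => //; exact: lt_trans rq.
move=> r r0 rt /(hit_le (cadlagN cX) r0 t0'); rewrite lerN2.
by apply/negP; rewrite -ltNge.
Qed.

Lemma defS_cadlag (X : R -> Omega -> R) (B : set R) : cadlag X -> adapted G X ->
  measurable B -> defS (fun p => B (X p.1 p.2)).
Proof.
move=> cX aX mB; have sS := sigma_splittable.
apply: (@sdef_borel _ _ _ sS R (fun p => X p.1 p.2)) mB => c.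
(* Time 0 has no left limit and is handled by the event [c < X 0 w] of [G 0]. *)
apply: (@sdef_ext _ _ _ (fun p => (0 < p.1 /\ above X c p.1 p.2) \/
    (~ (0 < p.1) /\ (0 <= p.1 /\ c < X 0 p.2)))) => [[t w] t0 /=|].
  have [tgt0|tle0] := ltP 0 t.
    split=> [[[_ /(cadlag_gtE w c cX tgt0)//]|[]//]|cXt].
    by left; split=> //; exact/(cadlag_gtE w c cX tgt0).
  have -> : t = 0 by apply: le_anti; rewrite tle0 t0.
  by split=> [[[]//|[_ []//]]|?]; right; split.
apply: sdef_or => //; last first.
  apply: sdef_and => //; first by apply: sdef_not => //; exact: defS_time.
  by apply: (@defS_ge 0 [set w | c < X 0 w]) => //; exact: X_gt_G.
apply: sdef_and => //; first exact: defS_time.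
apply: sdef_or => //.
  apply: sdef_ex => // -[a r] /=; apply: sdef_guard => // -[ca r0].
  by apply: sdef_and => //; [exact: defS_time|exact: defS_hit].
apply: sdef_ex => // b; apply: sdef_guard => // cb; apply: sdef_and => //.
  apply: sdef_ex => // r0; apply: sdef_guard => // r00.
  apply: sdef_and => //; first exact: defS_time.
  apply: sdef_all => // q; apply: sdef_guard_imply => // r0q.
  have q0 : 0 <= ratr q :> R by rewrite (le_trans r00)// ltW.
  (* The event on [X (ratr q)] is known to [G] only from time [ratr q] on, so the guard is repeated
     in the conclusion to form a set covered by [defS_gt]. *)
  apply: (@sdef_ext _ _ _ (fun p => ratr q < p.1 ->
      (ratr q < p.1 /\ ratr b < X (ratr q) p.2))) => [p _|].
    by split=> h qp; [case: (h qp)|split=> //; exact: h].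
  apply: sdef_imply => //; first exact: defS_time.
  by apply: (defS_gt q0 (A := [set w | ratr b < X (ratr q) w])); exact: X_gt_G.
apply: sdef_all => // r; apply: sdef_guard_imply => // r0.
apply: sdef_imply => //; first exact: defS_time.
apply: sdef_not => //; apply: defS_hit => //; [exact: cadlagN|exact: adaptedN].
Qed.

(** * From optional sets to optional processes *)

Lemma optional_splittable : optional G `<=` splittable.
Proof.
apply: smallest_sub; first exact: sigma_splittable.
by move=> _ [X [B [cX aX mB ->]]]; have [] := defS_cadlag cX aX mB.
Qed.

Lemma sdef_mem {T : Type} (D : set T) (S : set (set T)) (A : set T) :
  sigma_algebra D S -> S A -> sdef D S (fun x => A x).
Proof.
move=> sS SA; have [_ SC _] := sS; constructor; have := SC _ (SC _ SA); congr S.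
apply/seteqP; split=> x /=; last by move=> [Dx Ax]; split=> // -[].
by move=> [Dx n]; split=> //; apply: contrapT => nA; apply: n.
Qed.

Lemma splitting : global_optional_splitting Q F tau.
Proof.
move=> Y mY.
have /choice[S' /choice[S'' hS]] : forall c : rat, exists S' S'',
    [/\ optional F S', borel_optional F S'' &
    Q'.-negligible [set w : TG | exists t, 0 <= t /\
      ~ (ratr c < Y t w <-> if (t%:E < tau w)%E then S' (t, w) else S'' (tau w, (t, w)))]].
  move=> c; have [S' [S'' [OS BS neg]]] :=
    optional_splittable (mY _ (measurable_itv `]ratr c, +oo[)).
  exists S', S''; split=> //; apply: negligibleS neg => w [t [t0 h]].
  exists t; split=> // h'; apply: h; apply: iff_trans h'.
  by rewrite /= in_itv/= andbT; split=> [|[]].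
(* Off the exceptional set the rationals collected are those below [Y t w], with supremum [Y t w].
   Elsewhere [sup] may take its default value 0, and [sdef_sup] keeps measurability. *)
exists (fun t w => sup [set ratr c | c in [set c | S' c (t, w)]]).
exists (fun u t w => sup [set ratr c | c in [set c | S'' c (u, (t, w))]]); split.
- move=> B mB; have sO := sigma_optional F.
  have OS c : sdef timedom (optional F) (fun p => S' c p).
    by apply: sdef_mem => //; case: (hS c).
  have [h] := sdef_sup sO OS mB; move: h; congr (optional F).
  by apply/seteqP; split=> -[].
- move=> B mB; have sB := sigma_borel_optional F.
  have BS c : sdef ext_timedom (borel_optional F) (fun p => S'' c p).
    by apply: sdef_mem => //; case: (hS c).
  have [h] := sdef_sup sB BS mB; move: h; congr (borel_optional F).
  by apply/seteqP; split=> -[u [t w]].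
have neg : Q'.-negligible [set w : TG | exists c : rat, exists t, 0 <= t /\
      ~ (ratr c < Y t w <-> if (t%:E < tau w)%E then S' c (t, w) else S'' c (tau w, (t, w)))].
  by apply: negligible_ex => c; case: (hS c).
have [E [NE QE sE]] := negligible_Nsa neg.
exists E; split=> // w nE t t0.
have h c : ratr c < Y t w <-> if (t%:E < tau w)%E then S' c (t, w) else S'' c (tau w, (t, w)).
  by apply: contrapT => h; apply: nE; apply: sE; exists c, t.
by case: ifP h => _ h; rewrite -[LHS]rat_sup; congr sup; apply/seteqP; split=> _ [c /= cY <-];
  exists c => //=; exact/h.
Qed.

End setting.

Theorem mainTheorem14 (R : realType) (d : measure_display)
  (Omega : measurableType d) (Q : probability Omega R)
  (F : R -> set (set Omega)) (tau : Omega -> \bar R)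
  (hF : is_filtration F) (hFrc : right_continuous_filtration F)
  (hF0 : nullgen Q (infty_sa F) `<=` F 0)
  (htau_meas : measurable_fun setT tau)
  (htau_pos : forall w, (0 <= tau w)%E)
  (Q' : probability (g_sigma_algebraType (Ginf_gen Q F tau)) R)
  (hequiv : forall A : set Omega, <<s Ginf_gen Q F tau >> A ->
              (Q' A = 0%E <-> Q.-negligible A))
  (hH : forall M : R -> Omega -> R,
          martingale Q' F M -> martingale Q' (Gfilt Q F tau) M) :
  global_optional_splitting Q F tau.
Proof.
exact: splitting hequiv hH.
Qed.
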